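(* Let $\mathbf{Y}=(Y,\mathcal{B}_Y,\nu,S)$ be an ergodic measure-preserving $\mathbb{Z}$-system. Then the set of rigid cocycles $\alpha\in\operatorname{Co}(Y)$ is a dense $G_\delta$ subset of $\operatorname{Co}(Y)$.
   Context: $\mathbf{Y}$ is a system consisting of a standard probability space $(Y,\mathcal{B}_Y,\nu)$ and an invertible measure-preserving transformation $S$. $I$ is the unit interval with Lebesgue measure $m$, and $\operatorname{Aut}(I,m)$ is the group of measure-preserving automorphisms of $(I,m)$ modulo a.e. equality, with the weak topology: $\phi_n\to\phi$ iff $m(\phi_n^{-1}E\,\triangle\,\phi^{-1}E)\to0$ for all measurable $E\subseteq I$ (a Polish topological group). $\operatorname{Aut}(Y\times I,\nu\times m)$ and its weak topology are defined in the same way. A cocycle on $Y$ is a measurable map $\alpha:Y\to\operatorname{Aut}(I,m)$ (identified up to $\nu$-a.e. equality); $\operatorname{Co}(Y)$ is the set of all cocycles on $Y$. Each $\alpha$ induces the skew product $T_\alpha(y,t)=(Sy,\alpha(y)t)$ on $(Y\times I,\nu\times m)$, and $\operatorname{Co}(Y)$ carries the topology inherited from the weak topology on $\operatorname{Aut}(Y\times I,\nu\times m)$ under $\alpha\mapsto T_\alpha$. For $n\in\mathbb{N}$, $\alpha_n(y)=\alpha(S^{n-1}y)\circ\dots\circ\alpha(Sy)\circ\alpha(y)$. The cocycle $\alpha$ is rigid if for $\nu$-a.e. $y\in Y$ there is a sequence $n_1<n_2<\cdots$ (allowed to depend on $y$) such that $\alpha_{n_k}(y)\to\mathrm{id}$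 in $\operatorname{Aut}(I,m)$ as $k\to\infty$. *)

(* Defs.v *)
From HB Require Import structures.
From mathcomp Require Import all_boot all_order all_algebra.
From mathcomp Require Import all_classical all_reals all_analysis.

Set Implicit Arguments.
Unset Strict Implicit.
Unset Printing Implicit Defensive.

Import Order.TTheory GRing.Theory Num.Theory.
Import numFieldNormedType.Exports.

Local Open Scope classical_set_scope.
Local Open Scope ring_scope.
Local Open Scope ereal_scope.
Local Open Scope quotient_scope.

(* Y is measurably isomorphic to a Polish space with its Borel sets. *)
Definition standard_borel (R : realType) d (Y : measurableType d) : Prop :=
  exists (P : completePseudoMetricType R) (f : Y -> P),
    [/\ hausdorff_space P, @second_countable P, bijective f &
        forall A : set Y, measurable A <-> <<s @open P >> (f @` A)].

Definition unitI (R : realType) : Type := {x : R | x \in `[0%R, 1%R]}.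

Section unit_interval.
Context {R : realType}.

Lemma unitI0 : (0 : R)%R \in `[0%R, 1%R].
Proof. by rewrite in_itv/= lexx ler01. Qed.

HB.instance Definition _ := Choice.on (unitI R).
HB.instance Definition _ := isPointed.Build (unitI R) (exist _ 0%R unitI0).

Definition unitI_val (x : unitI R) : measurableTypeR R := sval x.

HB.instance Definition _ :=
  Measurable.copy (unitI R) (g_sigma_algebra_preimageType unitI_val).

Definition mI (A : set (unitI R)) : \bar R := lebesgue_measure (unitI_val @` A).

Lemma unitI_val_inj : injective unitI_val.
Proof. exact: val_inj. Qed.

Lemma range_unitI_val : range unitI_val = `[0%R, 1%R]%classic.
Proof.
apply/seteqP; split=> [_ [x _ <-]|x x01] /=; first exact: (svalP x).
by exists (exist _ x x01).
Qed.

Lemma measurable_unitI_image (A : set (unitI R)) :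
  measurable A -> measurable (unitI_val @` A).
Proof.
move=> mA; have [B mB BA] : exists2 B : set (measurableTypeR R),
    measurable B & setT `&` unitI_val @^-1` B = A by exact: mA.
rewrite -BA setTI.
rewrite (_ : _ @` _ = B `&` `[0%R, 1%R]%classic); last first.
  rewrite -range_unitI_val; apply/seteqP; split=> [_ [x Bx <-]|].
    by split => //; exists x.
  by move=> y [By [x _ xE]]; exists x; rewrite // /preimage /= xE.
by apply: measurableI => //; exact: measurable_itv.
Qed.

Let mI0 : mI set0 = 0.
Proof. by rewrite /mI image_set0 measure0. Qed.

Let mI_ge0 A : 0 <= mI A.
Proof. exact: measure_ge0. Qed.

Let mI_sigma_additive : semi_sigma_additive mI.
Proof.
move=> F mF tF mUF; rewrite /mI image_bigcup.
apply: measure_semi_sigma_additive.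
- by move=> i; exact: measurable_unitI_image.
- apply/trivIsetP => i j _ _ ij; apply/seteqP; split => // _ [] [x Fx <-].
  move=> [y Fy] /unitI_val_inj yx; rewrite yx in Fy.
  move/trivIsetP : tF => /(_ i j I I ij)/seteqP[+ _].
  by apply; split; [exact: Fx|].
- by apply: bigcupT_measurable => i; exact: measurable_unitI_image.
Qed.

HB.instance Definition _ := isMeasure.Build _ _ _ mI
  mI0 mI_ge0 mI_sigma_additive.

Let mI_setT : mI setT = 1.
Proof.
rewrite /mI range_unitI_val lebesgue_measure_itv/= lte_fin ltr01.
by rewrite -EFinB subr0.
Qed.

HB.instance Definition _ := Measure_isProbability.Build _ _ _ mI mI_setT.

End unit_interval.
Arguments mI : clear implicits.

Section automorphisms.
Context d (T : measurableType d) (R : realType).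
Variable mu : {measure set T -> \bar R}.

(* Every automorphism mod null sets agrees a.e. with an everywhere defined
   bimeasurable bijection, so bijections suffice as representatives. *)
Record mpaut := MpAut {
  aut_fun :> T -> T ;
  aut_inv : T -> T ;
  aut_funK : cancel aut_fun aut_inv ;
  aut_invK : cancel aut_inv aut_fun ;
  measurable_aut : measurable_fun setT aut_fun ;
  measurable_aut_inv : measurable_fun setT aut_inv ;
  aut_preserving : forall A, measurable A -> mu (aut_fun @^-1` A) = mu A }.

HB.instance Definition _ := gen_eqMixin mpaut.
HB.instance Definition _ := gen_choiceMixin mpaut.

Definition mpaut_eq (f g : mpaut) := `[< f = g %[ae mu] >].

Let mpaut_eq_refl : reflexive mpaut_eq.
Proof. by move=> f; exact/asboolP/ae_eq_refl. Qed.

Let mpaut_eq_sym : symmetric mpaut_eq.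
Proof. by move=> f g; apply/asboolP/asboolP => /ae_eq_sym. Qed.

Let mpaut_eq_trans : transitive mpaut_eq.
Proof.
by move=> g f h /asboolP fg /asboolP gh; exact/asboolP/(ae_eq_trans fg gh).
Qed.

Canonical mpaut_eq_equiv :=
  EquivRel mpaut_eq mpaut_eq_refl mpaut_eq_sym mpaut_eq_trans.

Definition mAut : Type := {eq_quot mpaut_eq}.
HB.instance Definition _ := Choice.on mAut.
HB.instance Definition _ := EqQuotient.on mAut.

Lemma mAutP (f g : mpaut) : (\pi_mAut f = \pi_mAut g) <-> (f = g %[ae mu]).
Proof.
by split=> [/eqP|fg]; [|apply/eqP]; rewrite eqmodE; [move/asboolP|apply/asboolP].
Qed.

Lemma repr_mAut (f : mpaut) : repr (\pi_mAut f) = f %[ae mu].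
Proof. by apply/mAutP; rewrite reprK. Qed.

Lemma ae_comp_mpaut (P : T -> Prop) (g : mpaut) :
  {ae mu, forall x, P x} -> {ae mu, forall x, P (g x)}.
Proof.
move=> [B [mB B0 PB]]; exists (g @^-1` B); split.
- by rewrite -[_ @^-1` _]setTI; exact: measurable_aut.
- by rewrite aut_preserving.
- by move=> x /= Pgx; exact: PB.
Qed.

Definition mpaut_id : mpaut :=
  @MpAut id id (fun=> erefl) (fun=> erefl) (@measurable_id _ T setT)
    (@measurable_id _ T setT) (fun _ _ => erefl).

Lemma mpaut_inv_preserving (f : mpaut) A :
  measurable A -> mu (aut_inv f @^-1` A) = mu A.
Proof.
move=> mA; rewrite -(aut_preserving f).
  by congr (mu _); apply/seteqP; split=> x /=; rewrite aut_funK.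
by rewrite -[_ @^-1` _]setTI; exact: measurable_aut_inv.
Qed.

Definition mpaut_inv (f : mpaut) : mpaut :=
  @MpAut (aut_inv f) f (@aut_invK f) (@aut_funK f)
    (measurable_aut_inv f) (measurable_aut f) (@mpaut_inv_preserving f).

Lemma mpaut_comp_preserving (f g : mpaut) A :
  measurable A -> mu ((f \o g) @^-1` A) = mu A.
Proof.
move=> mA; rewrite comp_preimage aut_preserving ?aut_preserving//.
by rewrite -[_ @^-1` _]setTI; exact: measurable_aut.
Qed.

Definition mpaut_comp (f g : mpaut) : mpaut :=
  @MpAut (f \o g) (aut_inv g \o aut_inv f)
    (can_comp (@aut_funK f) (@aut_funK g))
    (can_comp (@aut_invK g) (@aut_invK f))
    (measurableT_comp (measurable_aut f) (measurable_aut g))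
    (measurableT_comp (measurable_aut_inv g) (measurable_aut_inv f))
    (@mpaut_comp_preserving f g).

Definition mAut_one : mAut := \pi_mAut mpaut_id.
Definition mAut_mul (f g : mAut) : mAut :=
  \pi_mAut (mpaut_comp (repr f) (repr g)).
Definition mAut_inv (f : mAut) : mAut := \pi_mAut (mpaut_inv (repr f)).

Lemma mAut_mul_pi (f g : mpaut) :
  mAut_mul (\pi_mAut f) (\pi_mAut g) = \pi_mAut (mpaut_comp f g).
Proof.
apply/mAutP; have ff := repr_mAut f; have gg := repr_mAut g.
have := ae_comp_mpaut (repr (\pi_mAut g)) ff; apply: filterS2 gg => x /= h + _.
by rewrite h// => ->.
Qed.

Lemma mAut_mulA : associative mAut_mul.
Proof.
move=> f g h; rewrite -[f]reprK -[g]reprK -[h]reprK.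
rewrite (mAut_mul_pi (repr g) (repr h)) (mAut_mul_pi (repr f) (repr g)).
by rewrite !mAut_mul_pi; apply/mAutP; exact: aeW.
Qed.

Lemma mAut_mul1 : left_id mAut_one mAut_mul.
Proof.
by move=> f; rewrite -[f]reprK mAut_mul_pi; apply/mAutP; exact: aeW.
Qed.

Lemma mAut_mulV : left_inverse mAut_one mAut_inv mAut_mul.
Proof.
move=> f; rewrite -{2}[f]reprK mAut_mul_pi; apply/mAutP.
by apply: aeW => x _ /=; rewrite aut_funK.
Qed.

Lemma mAut_mulr1 : right_id mAut_one mAut_mul.
Proof.
by move=> f; rewrite -[f]reprK mAut_mul_pi; apply/mAutP; exact: aeW.
Qed.

Lemma mAut_mulrV : right_inverse mAut_one mAut_inv mAut_mul.
Proof.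
move=> f; rewrite -{1}[f]reprK mAut_mul_pi; apply/mAutP.
by apply: aeW => x _ /=; rewrite aut_invK.
Qed.

HB.instance Definition _ := isGroup.Build mAut
  mAut_mulA mAut_mul1 mAut_mulr1 mAut_mulV mAut_mulrV.

HB.instance Definition _ := isPointed.Build mAut mAut_one.

(* The measure of the symmetric difference of f^-1 E and g^-1 E. *)
Definition mAut_dist (E : set T) (f g : mAut) : \bar R :=
  mu ((repr f @^-1` E) `+` (repr g @^-1` E)).

(* Pullbacks of the balls of the measure algebra under f |-> f^-1 E; see
   [weak_cvgP] for the resulting convergence. *)
Definition weak_subbase : set (set mAut) :=
  [set U | exists E (f : mAut) (e : R),
    [/\ measurable E, (0 < e)%R & U = [set g | mAut_dist E g f < e%:E]]].

HB.instance Definition _ := isSubBaseTopological.Build mAut weak_subbase id.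

Lemma measurable_mpaut_preimage (f : mpaut) E :
  measurable E -> measurable (f @^-1` E).
Proof. by move=> mE; rewrite -[_ @^-1` _]setTI; exact: measurable_aut. Qed.

Lemma mAut_distxx E f : mAut_dist E f f = 0.
Proof. by rewrite /mAut_dist setYK measure0. Qed.

Lemma mAut_dist_triangle E f g h : measurable E ->
  mAut_dist E f h <= mAut_dist E f g + mAut_dist E g h.
Proof.
move=> mE; have mp (k : mAut) := measurable_mpaut_preimage (repr k) mE.
have mY (k l : mAut) : measurable (repr k @^-1` E `+` repr l @^-1` E).
  by apply: measurableU; apply: measurableD.
apply: (@le_trans _ _ (mu ((repr f @^-1` E `+` repr g @^-1` E) `|`
                           (repr g @^-1` E `+` repr h @^-1` E)))).
  apply: le_measure; rewrite ?inE; [exact: mY|exact: measurableU|].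
  by move=> x /=; have [] := pselect (E (repr g x)); tauto.
exact: measureU2.
Qed.

Lemma weak_cvgP (F : set_system mAut) (f : mAut) : Filter F ->
  F --> f <-> forall E, measurable E -> mAut_dist E g f @[g --> F] --> 0.
Proof.
move=> FF; split=> [Ff E mE|Ff A].
  have dlt (e : R) : (0 < e)%R -> \forall g \near F, mAut_dist E g f < e%:E.
    move=> e0; apply: Ff; rewrite (@nbhsE mAut).
    exists [set g | mAut_dist E g f < e%:E] => //; split; last first.
      by rewrite /= mAut_distxx lte_fin.
    exists [set [set g | mAut_dist E g f < e%:E]]; last by rewrite bigcup_set1.
    by move=> _ ->; apply: (@finI_from1 _ _ _ id); exists E, f, e.
  apply/fine_cvgP; split.
    near=> g; rewrite ge0_fin_numE ?measure_ge0//.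
    by apply: (@lt_trans _ _ 1); [near: g; exact: dlt|exact: ltry].
  apply/cvgr0Pnorm_lt => e e0; near=> g.
  have ge : mAut_dist E g f < e%:E by near: g; exact: dlt.
  rewrite /= ger0_norm ?fine_ge0 ?measure_ge0//.
  by rewrite -lte_fin fineK// ge0_fin_numE ?measure_ge0// (lt_trans ge)// ltry.
rewrite (@nbhsE mAut) => -[_ [[B sB <-] [C BC Cf] sUBA]].
rewrite nbhs_filterE; apply: filterS sUBA _; apply: (@filterS _ _ _ C).
  by move=> g Cg; exists C.
have /sB [D sD IDeC] := BC; rewrite -IDeC; apply: filter_bigI => U DU.
have Uf : U f by move: Cf; rewrite -IDeC => /(_ _ DU).
have /sD := DU; rewrite inE => -[E [h [e [mE e0 UE]]]].
move: Uf; rewrite UE /= => fhe.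
have fin : mAut_dist E f h \is a fin_num.
  by rewrite ge0_fin_numE ?measure_ge0// (lt_trans fhe)// ltry.
have : \forall g \near F, mAut_dist E g f < e%:E - mAut_dist E f h.
  have : nbhs (0 : \bar R) [set x | x < e%:E - mAut_dist E f h].
    apply: open_nbhs_nbhs; split; first exact: open_ereal_lt_ereal.
    by rewrite /= sube_gt0.
  exact: Ff.
apply: filterS => g /= ge.
by apply: le_lt_trans (mAut_dist_triangle g f h mE) _; rewrite -lteBrDr.
Unshelve. all: by end_near. Qed.

(* Borel sets of the weak topology. *)
HB.instance Definition _ :=
  Measurable.copy mAut (g_sigma_algebraType (@open mAut)).

End automorphisms.

Section cocycles.
Context d (Y : measurableType d) (R : realType).
Variables (nu : probability Y R) (S : mpaut nu).

Definition ergodic : Prop :=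
  forall A, measurable A -> S @^-1` A = A -> nu A = 0 \/ nu A = 1.

Definition cocycle : Type := {mfun_ nu, Y >-> mAut (mI R)}.

(* Pointwise representatives of the classes [alpha y] need not be jointly
   measurable in (y, t), so the equation T_alpha (y, t) = (S y, alpha(y) t) is
   required fiberwise: for a.e. y, for a.e. t. *)
Definition skew_lift (alpha : {mfun_ nu, Y >-> mAut (mI R)})
    (T : mAut (nu \x mI R)) : Prop :=
  {ae nu, forall y, {ae mI R, forall t,
    repr T (y, t) = (S y, repr (alpha y) t)}}.

(* When Y is standard Borel, exactly one T satisfies [skew_lift alpha T]: a
   measurable map from Y to Aut(I, m) has a jointly measurable realization, and
   Fubini gives uniqueness. *)
Definition skew_product (alpha : cocycle) : mAut (nu \x mI R) :=
  get (skew_lift alpha).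

Definition Co : Type := initial_topology skew_product.
HB.instance Definition _ := Topological.on Co.

Definition Co_fun (alpha : Co) : Y -> mAut (mI R) :=
  (alpha : {mfun_ nu, Y >-> mAut (mI R)}).
Coercion Co_fun : Co >-> Funclass.

Fixpoint Co_iter (alpha : Co) (n : nat) (y : Y) : mAut (mI R) :=
  if n is k.+1 then (alpha (iter k S y) * Co_iter alpha k y)%g else 1%g.

Definition rigid (alpha : Co) : Prop :=
  {ae nu, forall y, exists n : nat -> nat,
    (forall i j, (i < j)%N -> (n i < n j)%N) /\
    Co_iter alpha (n k) y @[k --> \oo] --> (1%g : mAut (mI R))}.

End cocycles.

(* Main.v *)
Require Import Defs.
From HB Require Import structures.
From mathcomp Require Import all_boot all_order all_algebra perm.
From mathcomp Require Import all_classical all_reals all_analysis borel_hierarchy.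
From mathcomp Require Import measurable_realfun.
From mathcomp Require Import ring lra.

(** Both halves rest on one reformulation.  Cut the unit interval into the
2 ^ M half-open dyadic cells of level M.  By Lebesgue differentiation along
these cells, every measurable set is, at almost every point and for all large
M, decided by majority vote inside the cell of that point ([cell_density]).
Hence f_k -> f weakly as soon as, at each level, the measure of the set where
f_k and f fall into different cells tends to 0 ([weak_cvg_cell_dist]).

Every cocycle has a skew product.  A measurable map from Y to Aut(I, m) only
gives classes fiber by fiber.  Majority votes turn the preimages of a fixed set
into one measurable subset of Y x I, a supremum of thresholds then gives a
jointly measurable realization, and the almost everywhere inverse pair made of
the realizations of the field and of its inverse becomes a genuine bijection on
an invariant set that is conull in each fiber ([skew_aut], [skew_productP]).
The n-th power of the skew product realizes alpha_n, and T |-> T ^ n is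
continuous, so integrals over Y of fiberwise quantities attached to alpha_n
depend continuously on alpha.

G-delta.  A cocycle is rigid exactly when, for all j and N, almost every y has
infimum over n >= N of the level-j distance from alpha_n(y) to the identity
equal to 0.  This says that the integrals of the minima over finitely many n
become smaller than any 1 / (k + 1), which is an open condition for each j, N
and k ([running_min_integralP], [open_recurrent_within], [rigidP]).

Density.  Permutations of the level-M cells form a finite subgroup of
Aut(I, m), and an automorphism f is weakly approximated by them
([shuffle_approx]): the majority value of the level-n cell of f on each
level-M cell is a labelling with almost the right number of cells for each
label, and a permutation can be made to follow it up to exactly the excess
([perm_match]).  Choosing for each y a best permutation at level M gives
cocycles beta_M that converge pointwise, hence in Co(Y), to the given one.
Each beta_M takes values in a finite group, and any such cocycle is rigid: in
the sequence of its iterates at y only finitely many terms have a value that is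
taken finitely often, so the orbit of y eventually stays among the points whose
iterates return to the identity infinitely often; by invariance of the measure
those points have full measure ([perm_iter_recurrent]). *)

Set Implicit Arguments.
Unset Strict Implicit.
Unset Printing Implicit Defensive.

Import Order.TTheory GRing.Theory Num.Theory.
Import numFieldNormedType.Exports.

Local Open Scope classical_set_scope.
Local Open Scope ring_scope.
Local Open Scope ereal_scope.

(** * Bounded convergence *)

Section bounded_convergence.
Context d (T : measurableType d) (R : realType) (mu : probability T R).

Lemma bounded_integral_cvg0 (u : nat -> T -> \bar R) :
  (forall n, measurable_fun setT (u n)) ->
  (forall n x, 0 <= u n x <= 1) ->
  {ae mu, forall x, u n x @[n --> \oo] --> 0} ->
  \int[mu]_x u n x @[n --> \oo] --> 0.
Proof.
move=> mu_ u01 u0.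
have [|||_ _] := @dominated_convergence _ _ _ mu setT measurableT u (cst 0)
  (cst 1) mu_ (@measurable_cst _ _ _ _ _ _).
- by apply: filterS u0 => x ux _.
- exact: finite_measure_integrable_cst.
- by apply: aeW => x n _; have /andP[u_ge0 u_le1] := u01 n x; rewrite gee0_abs.
- by rewrite integral0.
Qed.

(** How almost everywhere eventual statements are turned into convergence in
measure: integrate the indicators. *)
Lemma measure_cvg0 (B : nat -> set T) : (forall n, measurable (B n)) ->
  {ae mu, forall x, \forall n \near \oo, ~ B n x} ->
  mu (B n) @[n --> \oo] --> 0.
Proof.
move=> mB B0.
have -> : (fun n => mu (B n)) = (fun n => \int[mu]_x (\1_(B n) x)%:E).
  by apply/funext => n; rewrite integral_indic// setIT.
apply: bounded_integral_cvg0.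
- by move=> n; exact/measurable_EFinP/measurable_indic.
- move=> n x; rewrite indicE !lee_fin.
  by case: (_ \in _); rewrite /= ?ler01 ?lexx.
- apply: filterS B0 => x Bx; apply: cvg_near_cst.
  by apply: filterS Bx => n Bnx; rewrite indicE memNset.
Qed.

End bounded_convergence.

(** * Dyadic cells of the unit interval *)

Section cells.
Context {R : realType}.
Notation I := (unitI R).
Notation m := (mI R).
Implicit Types (M n k : nat) (t : I) (A : set I).

Lemma unitI_ge0 t : (0 <= unitI_val t)%R.
Proof. by have := svalP t; rewrite in_itv/= => /andP[]. Qed.

Lemma unitI_le1 t : (unitI_val t <= 1)%R.
Proof. by have := svalP t; rewrite in_itv/= => /andP[]. Qed.

Lemma measurable_unitI_val : measurable_fun setT (@unitI_val R).
Proof. by move=> _ B mB; exists B. Qed.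

Lemma measurable_unitI_fun d (T : measurableType d) (f : T -> I) :
  measurable_fun setT (fun x => unitI_val (f x)) -> measurable_fun setT f.
Proof.
move=> mf _ A [B mB <-]; rewrite !setTI.
by rewrite -[X in measurable X]setTI; exact: (mf measurableT B mB).
Qed.

(** The point 1 is alone in its cell, of index 2 ^ M; the other cells are half
open.  So permutations of the first 2 ^ M cells act by translations on the
whole interval, bijectively and not only up to a null set. *)
Definition cell M t : nat := Num.truncn (2 ^+ M * unitI_val t)%R.

Lemma cellE M t k :
  cell M t = k <-> (k%:R <= (2 ^+ M * unitI_val t : R) < k.+1%:R)%R.
Proof.
rewrite -truncn_eq ?mulr_ge0 ?exprn_ge0 ?unitI_ge0//.
by split => [<-|/eqP].
Qed.

Lemma measurable_cell M : measurable_fun setT (cell M).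
Proof.
move=> _ B _; rewrite setTI.
have -> : cell M @^-1` B = \bigcup_(k in B) (cell M @^-1` [set k]).
  by apply/seteqP; split=> [t Bt|t [k Bk /= ->]]; [exists (cell M t)|].
apply: bigcup_measurable => k _.
have -> : cell M @^-1` [set k] = @unitI_val R @^-1`
    ((fun x : R => 2 ^+ M * x)%R @^-1` `[k%:R, k.+1%:R[%classic).
  by apply/seteqP; split=> t /=; rewrite in_itv/= => /cellE.
rewrite -[X in measurable X]setTI; apply: measurable_unitI_val => //.
rewrite -[X in measurable X]setTI; apply: measurable_funM => //.
Qed.

Lemma measurable_cell_preimage M (B : set nat) : measurable (cell M @^-1` B).
Proof. by rewrite -[X in measurable X]setTI; exact: measurable_cell. Qed.

Lemma cell_lt M t : (cell M t < (2 ^ M).+1)%N.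
Proof.
rewrite ltnS -(ler_nat R) natrX.
have /cellE/andP[+ _] := erefl (cell M t); move/le_trans; apply.
by rewrite ler_piMr ?exprn_ge0// unitI_le1.
Qed.

Lemma cell_mono n M t : (n <= M)%N -> cell n t = (cell M t %/ 2 ^ (M - n))%N.
Proof.
move=> nM; apply/cellE.
have /cellE := erefl (cell M t); set k := cell M t => /andP[kl ku].
have p0 : (0 < 2 ^+ (M - n) :> R)%R by rewrite exprn_gt0.
have e : (2 ^+ M * unitI_val t = 2 ^+ (M - n) * (2 ^+ n * unitI_val t) :> R)%R.
  by rewrite mulrA -exprD subnK.
have d0 : (0 < 2 ^ (M - n))%N by rewrite expn_gt0.
rewrite -(ler_pM2l p0) -(ltr_pM2l p0) -e; apply/andP; split.
  by apply: le_trans kl; rewrite -natrX -natrM ler_nat mulnC leq_trunc_div.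
apply: lt_le_trans ku _; rewrite -natrX -natrM ler_nat mulnC.
by rewrite ltn_ceil.
Qed.

Lemma mI_cell M k : (k < 2 ^ M)%N ->
  m (cell M @^-1` [set k]) = ((2 ^+ M)^-1)%:E.
Proof.
move=> kM; rewrite /mI.
have p0 : (0 < 2 ^+ M :> R)%R by rewrite exprn_gt0.
have -> : unitI_val @` (cell M @^-1` [set k]) =
    `[(k%:R / 2 ^+ M)%R, (k.+1%:R / 2 ^+ M)%R[%classic.
  apply/seteqP; split=> [_ [t /cellE + <-]|x] /=; rewrite in_itv/=.
    by rewrite ler_pdivrMr// ltr_pdivlMr// mulrC.
  rewrite ler_pdivrMr// ltr_pdivlMr// => /andP[kx xk].
  have x01 : x \in `[0%R, 1%R].
    rewrite in_itv/= -(ler_pM2r p0) mul0r (le_trans _ kx) ?ler0n//=.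
    rewrite -(ler_pM2r p0) mul1r (le_trans (ltW xk))//.
    by rewrite -natrX ler_nat.
  by exists (exist _ x x01) => //; apply/cellE; rewrite mulrC; apply/andP.
rewrite lebesgue_measure_itv/= lte_fin ltr_pM2r ?invr_gt0// ltr_nat ltnSn.
by rewrite -EFinB -mulrBl -natrB// subSnn mul1r.
Qed.

Lemma mI_cell_ge M k : (2 ^ M <= k)%N -> m (cell M @^-1` [set k]) = 0.
Proof.
move=> kM; apply/eqP; rewrite -measure_le0 /= /mI.
rewrite -[leRHS](lebesgue_measure_set1 1%R).
apply: le_measure; rewrite ?inE//.
  by apply: measurable_unitI_image; exact: measurable_cell_preimage.
move=> _ [t /cellE /andP[kt _] <-] /=; apply/le_anti; rewrite unitI_le1 /=.
have p0 : (0 < 2 ^+ M :> R)%R by rewrite exprn_gt0.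
rewrite -(ler_pM2l p0) mulr1; apply: le_trans kt.
by rewrite -natrX ler_nat.
Qed.

Lemma mI_cell_le M k : m (cell M @^-1` [set k]) <= ((2 ^+ M)^-1)%:E.
Proof.
have [kM|kM] := ltnP k (2 ^ M); first by rewrite mI_cell.
by rewrite mI_cell_ge// lee_fin invr_ge0 exprn_ge0.
Qed.

Lemma ae_unitI (P : R -> Prop) : {ae @lebesgue_measure R, forall x, P x} ->
  {ae m, forall t, P (unitI_val t)}.
Proof.
move=> [N [mN N0 PN]]; exists (unitI_val @^-1` N); split.
- by exists N; rewrite ?setTI.
- apply/eqP; rewrite -measure_le0 /= /mI -N0; apply: le_measure; rewrite ?inE//.
    by apply: measurable_unitI_image; exists N; rewrite ?setTI.
  by move=> _ [t Nt <-].
- by move=> t /= Pt; exact: PN.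
Qed.

(** The cells around a point shrink nicely, so the proportion of A in the cell
of t tends to 0 or 1 for almost every t.  Only its comparison with one half
is kept: this needs no limit, hence stays measurable in parameters on which
A depends. *)
Lemma cell_density A : measurable A -> {ae m, forall t, \forall M \near \oo,
  A t <-> ((2 ^- M.+1)%:E < m (A `&` cell M @^-1` [set cell M t]))}.
Proof.
move=> mA.
pose A' : set (measurableTypeR R) := unitI_val @` A.
have mA' : measurable A' by exact: measurable_unitI_image.
pose fl M (x : R) : R := (Num.floor (2 ^+ M * x)%R)%:~R.
pose E (x : R) M := `[(fl M x / 2 ^+ M)%R, ((fl M x + 1) / 2 ^+ M)%R[%classic.
have p0 M : (0 < 2 ^+ M :> R)%R by rewrite exprn_gt0.
have flP M x : (fl M x <= 2 ^+ M * x < fl M x + 1)%R.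
  by have := floor_itv (2 ^+ M * x)%R; rewrite intrD.
have mE x M : lebesgue_measure (E x M) = (2 ^- M)%:E.
  rewrite lebesgue_measure_itv/= lte_fin ltr_pM2r ?invr_gt0// ltrDl ltr01.
  by rewrite -EFinB -mulrBl addrAC subrr add0r mul1r.
have nE x : nicely_shrinking x (E x).
  split=> [M|]; first exact: measurable_itv.
  have q0 M : (0 < 2 ^- M :> R)%R by rewrite invr_gt0.
  (* The ball of radius 2 ^- M around x contains the cell of x and has twice
     its measure. *)
  exists (2%R, fun M => PosNum (q0 M)); split => //=.
  - have := @cvg_geometric R 1%R (2^-1)%R.
    rewrite ger0_norm// invf_lt1// ltr1n => /(_ isT).
    by apply: cvg_trans; apply: near_eq_cvg; near=> M; rewrite /= mul1r exprVn.
  - move=> M z; rewrite /E/= in_itv/= ler_pdivrMr// ltr_pdivlMr// => /andP[].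
    move=> zl zu; have /andP[xl xu] := flP M x.
    rewrite /ball/= -(ltr_pM2l (p0 M)) mulfV ?gt_eqF//.
    rewrite -[X in (X * _)%R](gtr0_norm (p0 M)) -normrM mulrBr.
    rewrite mulrC in zl; rewrite mulrC in zu.
    by rewrite ltr_norml; apply/andP; split; lra.
  - move=> M; rewrite (lebesgue_measure_ball _ (ltW _))// mE -EFinM lee_fin.
    by rewrite mulr_natl.
have := lebesgue_differentiation (locally_integrable_indic openT mA').
move/ae_unitI; apply: filterS => t /(nice_lebesgue_differentiation nE
  (locally_integrable_indic openT mA')) D.
have flE M : fl M (unitI_val t) = (cell M t)%:R.
  rewrite /fl (_ : Num.floor _ = (cell M t)%:Z)//; apply: floor_def.
  by have /cellE := erefl (cell M t); rewrite intrD natr1.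
have eqE M : m (A `&` cell M @^-1` [set cell M t]) =
    lebesgue_measure (A' `&` E (unitI_val t) M).
  have cE s : E (unitI_val t) M (unitI_val s) <-> cell M s = cell M t.
    rewrite /E /= in_itv/= ler_pdivrMr// ltr_pdivlMr// mulrC flE natr1.
    by split=> /cellE.
  congr (lebesgue_measure _); apply/seteqP; split.
    by move=> _ [s [As /= st] <-]; split; [exists s|exact/cE].
  by move=> _ [[s As <-] /cE sE]; exists s.
have {}D : (2 ^+ M)%:E * m (A `&` cell M @^-1` [set cell M t])
    @[M --> \oo] --> (\1_A t : R)%:E.
  have -> : \1_A t = \1_A' (unitI_val t) :> R.
    rewrite !indicE; congr (nat_of_bool _)%:R; apply/idP/idP; rewrite !inE.
      by exists t.
    by move=> [s As] /unitI_val_inj <-.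
  apply: cvg_trans D; apply: near_eq_cvg; near=> M.
  rewrite integral_indic//=; last exact: measurable_itv.
  by rewrite mE inver gt_eqF ?invr_gt0// invrK eqE.
have /fine_cvgP[_ /cvgrPdist_lt /(_ 2^-1%R)] := D.
rewrite invr_gt0 ltr0n => /(_ isT); apply: filterS => M /=.
set mA0 := m _; have : mA0 \is a fin_num.
  apply: fin_num_measure; apply: measurableI => //.
  exact: measurable_cell_preimage.
case: mA0 => // v _; rewrite -EFinM/= lte_fin indicE.
have -> : (2 ^- M.+1 < v)%R = (1 < 2 * (2 ^+ M * v))%R.
  by rewrite mulrA -exprS mulrC -ltr_pdivrMr ?mul1r// exprn_gt0.
set w := (2 ^+ M * v)%R; have [At|At] := boolP (t \in A); rewrite /= ltr_norml.
  by move=> /andP[h1 h2]; split => [_|_]; [lra|exact: set_mem].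
move=> /andP[h1 h2]; split => [/mem_set|h]; first by rewrite (negPf At).
by exfalso; lra.
Unshelve. all: by end_near. Qed.

End cells.

(** * Majority votes and the weak topology *)

Section cell_approximation.
Context {R : realType}.
Notation I := (unitI R).
Notation m := (mI R).

(** The threshold is half of the measure of a cell. *)
Definition majority (A : set I) M : set nat :=
  [set k | (2 ^- M.+1)%:E < m (A `&` cell M @^-1` [set k])].

Lemma measurable_setY d (T : measurableType d) (A B : set T) :
  measurable A -> measurable B -> measurable (A `+` B).
Proof. by move=> mA mB; apply: measurableU; exact: measurableD. Qed.

Lemma majority_cvg (A : set I) : measurable A ->
  m (A `+` cell M @^-1` majority A M) @[M --> \oo] --> 0.
Proof.
move=> mA; apply: measure_cvg0 => [M|].
  by apply: measurable_setY => //; exact: measurable_cell_preimage.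
apply: filterS (cell_density mA) => t; apply: filterS => M h.
by move=> [[At]|[/h]]//; apply; exact/h.
Qed.

(** The label of a cell is the value that h takes on more than half of it; two
values cannot both do so.  Almost every t has eventually h t as its label. *)
Lemma label_approx (h : I -> nat) : measurable_fun setT h ->
  exists l : nat -> nat -> nat,
    m [set t | l M (cell M t) <> h t] @[M --> \oo] --> 0.
Proof.
move=> mh.
have mhj j : measurable (h @^-1` [set j]).
  by rewrite -[X in measurable X]setTI; exact: mh.
have uniq M k i j : majority (h @^-1` [set i]) M k ->
    majority (h @^-1` [set j]) M k -> i = j.
  rewrite /majority/= => hi hj; apply: contrapT => ij.
  have mc := @measurable_cell_preimage R M [set k].
  have := @mI_cell_le R M k; apply/negP; rewrite -ltNge.
  apply: (@lt_le_trans _ _ (m (h @^-1` [set i] `&` cell M @^-1` [set k] `|`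
                           (h @^-1` [set j] `&` cell M @^-1` [set k])))).
    rewrite measureU//; [|exact: measurableI|exact: measurableI|].
      have -> : 2 ^- M = (2 ^- M.+1 + 2 ^- M.+1)%R :> R.
        by rewrite exprS invfM; field; rewrite expf_neq0.
      by rewrite EFinD; apply: lteD.
    apply/seteqP; split => // t [[/= hti _] [/= htj _]].
    by apply: ij; rewrite -hti -htj.
  by apply: le_measure; rewrite ?inE//;
    [apply: measurableU; exact: measurableI|move=> t [][]].
exists (fun M k => xget 0%N [set j | majority (h @^-1` [set j]) M k]).
apply: measure_cvg0 => [M|].
  pose l k := xget 0%N [set j | majority (h @^-1` [set j]) M k].
  rewrite -/(l _).
  have -> : [set t | l (cell M t) <> h t] =
      \bigcup_j (cell M @^-1` (l @^-1` [set j]) `\` h @^-1` [set j]).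
    apply/seteqP; split=> [t lt|t [j _ [/= <- /nesym]]]//.
    by exists (l (cell M t)) => //; split => //= /esym.
  apply: bigcup_measurable => j _; apply: measurableD => //.
  exact: measurable_cell_preimage.
have : {ae m, forall t, forall j, \forall M \near \oo,
    (h @^-1` [set j]) t <-> majority (h @^-1` [set j]) M (cell M t)}.
  by apply: ae_foralln => j; exact: cell_density.
apply: filterS => t /(_ (h t)); apply: filterS => M /= [/(_ erefl) hM _].
by apply; apply: xget_unique => // j hj; exact: uniq hj hM.
Qed.

Definition cell_dist n (f g : I -> I) : \bar R :=
  m [set t | cell n (f t) <> cell n (g t)].

Lemma measurable_cell_neq d (T : measurableType d) n (f g : T -> I) :
  measurable_fun setT f -> measurable_fun setT g ->
  measurable [set t | cell n (f t) <> cell n (g t)].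
Proof.
move=> mf mg.
have -> : [set t | cell n (f t) <> cell n (g t)] =
    \bigcup_k (f @^-1` (cell n @^-1` [set k]) `\`
               g @^-1` (cell n @^-1` [set k])).
  apply/seteqP; split=> [t lt|t [k _ [/= <- /nesym]]]//.
  by exists (cell n (f t)) => //; split => //= /esym.
by apply: bigcup_measurable => k _; apply: measurableD;
  rewrite -[X in measurable X]setTI; [apply: mf|apply: mg] => //;
  exact: measurable_cell_preimage.
Qed.

Lemma cell_dist_mono n M (f g : I -> I) : (n <= M)%N ->
  measurable_fun setT f -> measurable_fun setT g ->
  cell_dist n f g <= cell_dist M f g.
Proof.
move=> nM mf mg; apply: le_measure; rewrite ?inE;
  try exact: measurable_cell_neq.
by move=> t /=; apply: contra_not => fg; rewrite !(cell_mono _ nM) fg.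
Qed.

(** A measurable set E is, up to small measure, a union of cells of one level.
Since g and f preserve the measure, the preimages of E and of that union are
equally close, and preimages of a union of cells can only differ where g and
f fall into different cells. *)
Lemma weak_cvg_cell_dist (F : set_system (mAut m)) (f : mAut m) : Filter F ->
  (forall n, cell_dist n (repr (g : mAut m)) (repr f) @[g --> F] --> 0) ->
  F --> f.
Proof.
move=> FF Ff; apply/weak_cvgP => E mE.
have fin (A : set I) : measurable A -> m A \is a fin_num.
  by move=> mA; exact: fin_num_measure.
have mp (g : mAut m) (A : set I) : measurable A -> measurable (repr g @^-1` A).
  exact: measurable_mpaut_preimage.
have mY (g : mAut m) : measurable (repr g @^-1` E `+` repr f @^-1` E).
  by apply: measurable_setY; exact: mp.
apply/fine_cvgP; split; first by apply: nearW => g; apply: fin.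
apply/cvgr0Pnorm_lt => e e0.
have e3 : (0 < e / 3)%R by rewrite divr_gt0.
have [M ME] : exists M, m (E `+` cell M @^-1` majority E M) < (e / 3)%:E.
  have /fine_cvgP[_ /cvgr0Pnorm_lt /(_ _ e3)] := majority_cvg mE.
  move=> [M _ /(_ M (leqnn M))] /=; exists M.
  rewrite -[ltLHS]fineK; last first.
    apply: fin; apply: measurable_setY => //.
    exact: measurable_cell_preimage.
  by rewrite lte_fin (le_lt_trans (ler_norm _)).
set P := majority E M in ME *.
have mD : measurable (E `+` cell M @^-1` P).
  by apply: measurable_setY => //; exact: measurable_cell_preimage.
have /fine_cvgP[_ /cvgr0Pnorm_lt /(_ _ e3)] := Ff M.
apply: filterS => g /= ge.
have {}ge : cell_dist M (repr g) (repr f) < (e / 3)%:E.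
  rewrite -[ltLHS]fineK; last first.
    by apply: fin; apply: measurable_cell_neq; exact: measurable_aut.
  by rewrite lte_fin (le_lt_trans (ler_norm _)).
rewrite ger0_norm ?fine_ge0 ?measure_ge0// -lte_fin fineK ?fin//.
have mc : measurable [set t | cell M (repr g t) <> cell M (repr f t)].
  by apply: measurable_cell_neq; exact: measurable_aut.
apply: (@le_lt_trans _ _ (m (repr g @^-1` (E `+` cell M @^-1` P)) +
   m (repr f @^-1` (E `+` cell M @^-1` P)) +
   cell_dist M (repr g) (repr f))).
  apply: le_trans (leeD2r _ (measureU2 _ _ _)); [|exact: mp|exact: mp].
  apply: le_trans (measureU2 _ _ _); [|by apply: measurableU; exact: mp|by []].
  apply: le_measure; rewrite ?inE//.
    by apply: measurableU => //; apply: measurableU; exact: mp.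
  move=> t; have [fg|fg] := pselect (cell M (repr g t) = cell M (repr f t));
    last by right.
  rewrite /setY/= fg => ?; left.
  by have [] := pselect (P (cell M (repr f t))); tauto.
rewrite !aut_preserving//.
have -> : (e = e / 3 + e / 3 + e / 3)%R by lra.
by rewrite !EFinD; apply: lteD => //; apply: lteD.
Qed.

End cell_approximation.

(** * Measurable realization of a field of maps *)

Section product_ae.
Context d1 d2 (X : measurableType d1) (Z : measurableType d2) (R : realType).
Variables (mu : probability X R) (rho : probability Z R).

Lemma ae_prod (P : X * Z -> Prop) : {ae (mu \x rho), forall z, P z} ->
  {ae mu, forall x, {ae rho, forall z, P (x, z)}}.
Proof.
move=> [N [mN N0 PN]].
have mx := measurable_fun_xsection rho mN.
have /ae_eq_integral_abs : \int[mu]_(x in setT) `|(rho \o xsection N) x| = 0.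
  by under eq_integral do rewrite gee0_abs//; exact: N0.
move=> /(_ measurableT mx); apply: filterS => x /= /(_ I) xN.
exists (xsection N x); split => //; first exact: measurable_xsection.
by move=> z Pz; rewrite xsectionE; exact: PN.
Qed.

End product_ae.

Section measurable_eq.
Context {R : realType} d (T : measurableType d).

Lemma measurable_eq_unitI (f g : T -> unitI R) :
  measurable_fun setT f -> measurable_fun setT g ->
  measurable [set x | f x = g x].
Proof.
move=> mf mg.
have mv (h : T -> unitI R) : measurable_fun setT h ->
    measurable_fun setT (fun x => unitI_val (h x) : R).
  by move=> mh; apply: measurableT_comp; [exact: measurable_unitI_val|].
have := measurable_fun_eqr (mv _ mf) (mv _ mg).
move=> /(_ measurableT [set true] I); rewrite setTI.
congr (measurable _); apply/seteqP; split=> x /= => [/eqP/unitI_val_inj//|->].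
exact: eqxx.
Qed.

End measurable_eq.

Section realization.
Context d (Y : measurableType d) (R : realType).
Notation I := (unitI R).
Notation m := (mI R).

(** Measurability of y |-> a y tested on the measure algebra.  Nothing is asked
of the map (y, t) |-> a y t. *)
Definition slice_measurable (a : Y -> I -> I) := forall D J,
  measurable D -> measurable J ->
  measurable_fun setT (fun y => m (a y @^-1` D `&` J)).

Variable a : Y -> I -> I.
Hypothesis ma : forall y, measurable_fun setT (a y).
Hypothesis sa : slice_measurable a.

(** A point (y, t) is put in A when it wins the majority vote for the preimage
of D at all large levels.  At each level the vote depends on y through one
measure and on t through a cell index, which makes it jointly measurable. *)
Lemma realize_set D : measurable D -> exists2 A : set (Y * I), measurable A &
  forall y, {ae m, forall t, A (y, t) <-> D (a y t)}.
Proof.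
move=> mD.
pose B M : set (Y * I) :=
  [set z | majority (a z.1 @^-1` D) M (cell M z.2)].
have mB M : measurable (B M).
  have -> : B M = \bigcup_k
     ([set y | majority (a y @^-1` D) M k] `*` (cell M @^-1` [set k])).
    apply/seteqP; split=> [[y t] /= h|[y t] [k _ [/= h tk]]].
      by exists (cell M t).
    by rewrite /B /= tk.
  apply: bigcup_measurable => k _; apply: measurableX; last first.
    exact: measurable_cell_preimage.
  have := sa mD (@measurable_cell_preimage R M [set k]).
  move=> /(_ measurableT `](2 ^- M.+1)%:E, +oo[%classic).
  rewrite setTI => h; have := h (emeasurable_itv _); congr (measurable _).
  by apply/seteqP; split=> y; rewrite /majority /= in_itv/= andbT.
exists (\bigcup_N \bigcap_(M in [set M | (N <= M)%N]) B M).
  by apply: bigcup_measurable => N _; exact: bigcap_measurableType.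
move=> y.
have mDy : measurable (a y @^-1` D).
  by rewrite -[X in measurable X]setTI; exact: ma.
apply: filterS (cell_density mDy) => t -[N _ h]; split.
  move=> [N' _ AN']; have := AN' (maxn N N') (leq_maxr _ _).
  by move=> hB; apply/(h (maxn N N') (leq_maxl _ _)).
by move=> At; exists N => // M /h [+ _]; apply.
Qed.

(** With A_q realizing the event a y t >= q, the value a y t is the supremum of
the rationals q in [0, 1] for which (y, t) lies in A_q. *)
Lemma realize_fun : exists2 F : Y * I -> I, measurable_fun setT F &
  forall y, {ae m, forall t, F (y, t) = a y t}.
Proof.
pose r j : R := if (unpickle j : option rat) is Some q then
  (if (0 <= (ratr q : R) <= 1)%R then ratr q else 0%R) else 0%R.
have r01 j : (0 <= r j <= 1)%R.
  by rewrite /r; case: (unpickle j) => [q|]; [case: ifP|]; rewrite ?lexx ?ler01.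
pose D j : set I := [set s | (r j <= (unitI_val s : R))%R].
have mD j : measurable (D j).
  exists `[r j, +oo[%classic; first exact: measurable_itv.
  by rewrite setTI; apply/seteqP; split=> s; rewrite /D/= in_itv/= andbT.
pose A j := sval (cid2 (realize_set (mD j))).
have mA j : measurable (A j) by rewrite /A; case: cid2.
have AD j y : {ae m, forall t, A j (y, t) <-> D j (a y t)}.
  by rewrite /A; case: cid2.
pose f j (z : Y * I) : R := (r j * \1_(A j) z)%R.
have f01 j z : (0 <= f j z <= 1)%R.
  rewrite /f indicE; have /andP[r0 r1] := r01 j.
  by case: (_ \in _); rewrite ?mulr1 ?mulr0 ?lexx ?ler01 ?r0.
have ubf z : has_ubound (range (f ^~ z)).
  by exists 1%R => _ [j _ <-]; have /andP[] := f01 j z.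
pose F0 (z : Y * I) : R := sups (f ^~ z) 0%N.
have F0E z : F0 z = sup (range (f ^~ z)).
  by congr sup; apply/seteqP; split=> x [j _ <-]; exists j.
have mF0 : measurable_fun setT F0.
  apply: measurable_fun_sups => // j.
  by apply: measurable_funM => //; exact: measurable_indic.
have F001 z : F0 z \in `[0%R, 1%R].
  rewrite in_itv/= F0E; apply/andP; split.
    apply: le_trans (_ : f 0%N z <= _)%R; first by have /andP[] := f01 0%N z.
    by apply: ub_le_sup => //; exists 0%N.
  apply: ge_sup; first by exists (f 0%N z), 0%N.
  by move=> _ [j _ <-]; have /andP[] := f01 j z.
exists (fun z => exist _ (F0 z) (F001 z) : I).
  exact: measurable_unitI_fun.
move=> y; have : {ae m, forall t, forall j, A j (y, t) <-> D j (a y t)}.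
  by apply: ae_foralln => j; exact: AD.
apply: filterS => t h; apply: unitI_val_inj; rewrite /unitI_val/= F0E.
set s := a y t in h *; rewrite -[sval s]/(unitI_val s).
apply/le_anti/andP; split.
  apply: ge_sup; first by exists (f 0%N (y, t)), 0%N.
  move=> _ [j _ <-]; rewrite /f indicE; case: (boolP (_ \in _)); last first.
    by rewrite mulr0 unitI_ge0.
  by rewrite inE mulr1 => /h.
apply/ler_addgt0Pr => e e0; rewrite -lerBlDr.
have s0 := unitI_ge0 s; have s1 := unitI_le1 s.
have [se|se] := leP (unitI_val s - e)%R 0%R.
  apply: (le_trans se); have := F001 (y, t).
  by rewrite in_itv/= F0E => /andP[].
have [q] : exists q, (ratr q : R) \in `](unitI_val s - e)%R, (unitI_val s : R)[.
  by apply: rat_in_itvoo; rewrite ltrBlDr ltrDl.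
rewrite in_itv/= => /andP[qe qs].
have rq : r (pickle q) = ratr q.
  by rewrite /r pickleK (ltW (lt_trans se qe)) (le_trans (ltW qs)).
apply: le_trans (_ : f (pickle q) (y, t) <= _)%R; last first.
  by apply: ub_le_sup => //; exists (pickle q).
rewrite /f indicE mem_set ?mulr1 ?rq ?(ltW qe)//.
by apply/h; rewrite /D /= rq ltW.
Qed.

End realization.

(** * Existence of skew products *)

Section automorphism_lemmas.
Context d (T : measurableType d) (R : realType).
Variable mu : {measure set T -> \bar R}.

Lemma ae_iter_mpaut (P : T -> Prop) (f : mpaut mu) :
  {ae mu, forall x, P x} -> {ae mu, forall x, forall n, P (iter n f x)}.
Proof.
move=> aeP; apply: ae_foralln => n; elim: n P aeP => [//|n IH] P aeP.
exact: IH (ae_comp_mpaut f aeP).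
Qed.

Lemma ae_eq_measure (A B : set T) : measurable A -> measurable B ->
  {ae mu, forall x, A x <-> B x} -> mu A = mu B.
Proof.
move=> mA mB [N [mN N0 hN]].
suff h (C D : set T) : measurable C -> measurable D ->
    (forall x, ~ N x -> C x -> D x) -> mu C <= mu D.
  by apply/le_anti/andP; split; apply: h => // x xN xC;
    apply: contrapT => xD; apply: xN; apply: hN => /= -[? ?]; tauto.
move=> mC mD CD; rewrite -[leRHS]adde0 -N0.
apply: le_trans (measureU2 _ mD mN); apply: le_measure; rewrite ?inE//.
  exact: measurableU.
by move=> x Cx; have [xN|xN] := pselect (N x); [right|left; exact: CD].
Qed.

Lemma near_mAut_dist E (f : mAut mu) (e : R) : measurable E -> (0 < e)%R ->
  \forall g \near f, mAut_dist E g f < e%:E.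
Proof.
move=> mE e0; have /weak_cvgP/(_ E mE) : f --> f by exact: cvg_id.
have : nbhs (0 : \bar R) [set x | x < e%:E].
  apply: open_nbhs_nbhs; split; first exact: open_ereal_lt_ereal.
  by rewrite /= lte_fin.
by move=> /[swap]; apply.
Qed.

Lemma integral_mpaut (f : mpaut mu) (u : T -> \bar R) :
  measurable_fun setT u -> (forall x, 0 <= u x) ->
  \int[mu]_x u (f x) = \int[mu]_x u x.
Proof.
move=> mu_ u0.
rewrite -(ge0_integral_pushforward (measurable_aut f) mu measurableT)//.
apply: eq_measure_integral => [|mf A mA _]; first exact: measurable_aut.
by rewrite -[RHS](aut_preserving f mA).
Qed.

End automorphism_lemmas.

Section slice_measurability.
Context {R : realType}.
Notation m := (mI R).

(** The function is 1-Lipschitz for the pseudo-distance attached to D, so its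
strict superlevel sets are open. *)
Lemma measurable_mAut_meet D J : measurable D -> measurable J ->
  measurable_fun setT (fun f : mAut m => m (repr f @^-1` D `&` J)).
Proof.
move=> mD mJ; apply: (measurability _ (ErealGenOInfty.measurableE R)).
move=> /= _ [_ [r ->]] <-; rewrite setTI.
apply: sub_sigma_algebra.
rewrite openE => f /=; rewrite in_itv/= andbT => rf.
have mp (g : mAut m) : measurable (repr g @^-1` D).
  exact: measurable_mpaut_preimage.
have fin (g : mAut m) : m (repr g @^-1` D `&` J) \is a fin_num.
  by apply: fin_num_measure; exact: measurableI.
pose e := (fine (m (repr f @^-1` D `&` J)) - r)%R.
have e0 : (0 < e)%R by rewrite subr_gt0 -lte_fin fineK.
apply: filterS (near_mAut_dist f mD e0) => g /= ge.
rewrite in_itv/= andbT.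
have : m (repr f @^-1` D `&` J) <= m (repr g @^-1` D `&` J) + mAut_dist D g f.
  have mY : measurable (repr g @^-1` D `+` repr f @^-1` D).
    exact: measurable_setY.
  apply: le_trans (measureU2 _ _ _) => //; last exact: measurableI.
  apply: le_measure; rewrite ?inE; [exact: measurableI| |].
    by apply: measurableU => //; exact: measurableI.
  move=> t [ft Jt]; have [gt|gt] := pselect ((repr g @^-1` D) t); [by left|].
  by right; right.
rewrite /= -(fineK (fin f)) -(fineK (fin g)) lte_fin => h.
apply: contraTT h; rewrite -leNgt -ltNge => gr.
apply: (@lt_le_trans _ _ ((fine (m (repr g @^-1` D `&` J)))%:E + e%:E)).
  by rewrite lteD2lE.
by rewrite -EFinD lee_fin /e; lra.
Qed.

End slice_measurability.

Section lift.
Context d (Y : measurableType d) (R : realType).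
Notation I := (unitI R).
Notation m := (mI R).

Lemma slice_measurable_inv (a : Y -> mpaut m) :
  slice_measurable a -> slice_measurable (fun y => aut_inv (a y)).
Proof.
move=> sa D J mD mJ.
have -> : (fun y => m (aut_inv (a y) @^-1` D `&` J)) =
    (fun y => m (a y @^-1` J `&` D)).
  apply/funext => y; rewrite -(aut_preserving (a y)); last first.
    apply: measurableI => //; rewrite -[X in measurable X]setTI.
    exact: measurable_aut_inv.
  by congr (m _); apply/seteqP; split=> t /=; rewrite aut_funK => -[].
exact: sa.
Qed.

(** Realizations F of the field and G of its inverse are inverse to each other
only almost everywhere.  Let X be the set of points all of whose iterates
under both maps see F and G cancel.  Then F and G restrict to inverse
bijections of X, each fiber of X is conull, and outside X both maps are
replaced by the identity. *)
Lemma vertical_aut (a : Y -> mpaut m) : slice_measurable a ->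
  exists Phi Gam : Y * I -> Y * I,
  [/\ measurable_fun setT Phi /\ measurable_fun setT Gam,
      cancel Phi Gam /\ cancel Gam Phi,
      forall z, (Phi z).1 = z.1 &
      forall y, {ae m, forall t, Phi (y, t) = (y, a y t)}].
Proof.
move=> sa.
have [F mF Fa] := realize_fun (fun y => measurable_aut (a y)) sa.
have [G mG Ga] := realize_fun (fun y => measurable_aut_inv (a y))
  (slice_measurable_inv sa).
pose Phi0 z := (z.1, F z); pose Gam0 z := (z.1, G z).
have mPhi0 : measurable_fun setT Phi0 by exact: measurable_fun_pair.
have mGam0 : measurable_fun setT Gam0 by exact: measurable_fun_pair.
pose B := [set z | G (Phi0 z) = z.2] `&` [set z | F (Gam0 z) = z.2].
have mB : measurable B.
  apply: measurableI; apply: measurable_eq_unitI => //;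
    exact: measurableT_comp.
pose X := \bigcap_n ((iter n Phi0 @^-1` B) `&` (iter n Gam0 @^-1` B)).
have miter (f : Y * I -> Y * I) n : measurable_fun setT f ->
    measurable_fun setT (iter n f).
  move=> mf; elim: n => [|n IH]; first exact: measurable_id.
  exact: measurableT_comp mf IH.
have mX : measurable X.
  apply: bigcap_measurableType => n _; apply: measurableI;
    rewrite -[X in measurable X]setTI; exact: miter.
have XB z : X z -> B z by move=> /(_ 0%N Logic.I) [].
have PhiK z : X z -> Gam0 (Phi0 z) = z.
  by move=> /XB[/= h _]; rewrite /Gam0 h; case: z {h}.
have GamK z : X z -> Phi0 (Gam0 z) = z.
  by move=> /XB[/= _ h]; rewrite /Phi0 h; case: z {h}.
have XPhi z : X z -> X (Phi0 z).
  move=> Xz n _; split; first by have [] := Xz n.+1 Logic.I; rewrite /= -iterSr.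
  case: n => [|n]; first by have [] := Xz 1%N Logic.I.
  by rewrite /= -iterS iterSr PhiK//; have [] := Xz n Logic.I.
have XGam z : X z -> X (Gam0 z).
  move=> Xz n _; split; last by have [] := Xz n.+1 Logic.I; rewrite /= -iterSr.
  case: n => [|n]; first by have [] := Xz 1%N Logic.I.
  by rewrite /= -iterS iterSr GamK//; have [] := Xz n Logic.I.
pose fix_on (f : Y * I -> Y * I) z := if z \in X then f z else z.
have mfix f : measurable_fun setT f -> measurable_fun setT (fix_on f).
  move=> mf; apply: measurable_fun_ifT => //.
  by apply: (measurable_fun_bool true); rewrite setTI preimage_mem_true.
exists (fix_on Phi0), (fix_on Gam0); split.
- by split; exact: mfix.
- split=> z; rewrite {2}/fix_on; case: ifPn => zX.
  + by rewrite /fix_on mem_set ?PhiK//; [exact: set_mem|exact/XPhi/set_mem].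
  + by rewrite /fix_on (negbTE zX).
  + by rewrite /fix_on mem_set ?GamK//; [exact: set_mem|exact/XGam/set_mem].
  + by rewrite /fix_on (negbTE zX).
- by move=> z; rewrite /fix_on; case: ifP.
move=> y; pose f := a y.
pose Q t := [/\ F (y, t) = f t, G (y, t) = aut_inv f t,
  F (y, aut_inv f t) = t & G (y, f t) = t].
have aeQ : {ae m, forall t, Q t}.
  have h1 := ae_comp_mpaut (mpaut_inv f) (Fa y).
  have h2 := ae_comp_mpaut f (Ga y).
  apply: filterS2 (filterI (Fa y) (Ga y)) (filterI h1 h2).
  move=> t /= [q1 q2] [q3 q4].
  by split; rewrite ?q1 ?q2 ?q3 ?q4 ?aut_funK ?aut_invK.
apply: filterS2 (ae_iter_mpaut f aeQ) (ae_iter_mpaut (mpaut_inv f) aeQ).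
move=> t Q1 Q2; rewrite /fix_on mem_set; last first.
  have QB s : Q s -> B (y, s).
    by move=> [q1 q2 q3 q4]; split; rewrite /= /Phi0 /Gam0/= ?q1 ?q2.
  move=> n _; split => /=.
    have -> : iter n Phi0 (y, t) = (y, iter n f t).
      elim: n => //= n ->; rewrite /Phi0/=; congr (_, _).
      by have [] := Q1 n.
    exact/QB/Q1.
  have -> : iter n Gam0 (y, t) = (y, iter n (aut_inv f) t).
    elim: n => //= n ->; rewrite /Gam0/=; congr (_, _).
    by have [] := Q2 n.
  exact/QB/Q2.
by rewrite /Phi0; have [/= ->] := Q1 0%N.
Qed.

Variables (nu : probability Y R) (S : mpaut nu).

(** The composite of a vertical automorphism with S x id; it preserves the
product measure by integration over the fibers. *)
Lemma skew_aut (a : Y -> mpaut m) : slice_measurable a ->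
  exists T : mpaut (nu \x m),
    forall y, {ae m, forall t, T (y, t) = (S y, a y t)}.
Proof.
move=> sa.
have [Phi [Gam [[mPhi mGam] [PhiK GamK] Phi1 Phia]]] := vertical_aut sa.
have Gam1 z : (Gam z).1 = z.1 by rewrite -{2}(GamK z) Phi1.
pose T z := (S z.1, (Phi z).2).
pose T' z := Gam (aut_inv S z.1, z.2).
have TK : cancel T T'.
  by move=> z; rewrite /T' /T /= aut_funK -Phi1 -surjective_pairing PhiK.
have T'K : cancel T' T.
  by move=> [y t]; rewrite /T' /T /= GamK Gam1/= aut_invK.
have mT : measurable_fun setT T.
  apply: measurable_fun_pair; last exact: measurableT_comp.
  by apply: measurableT_comp => //; exact: measurable_aut.
have mT' : measurable_fun setT T'.
  apply: measurableT_comp => //; apply: measurable_fun_pair => //.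
  by apply: measurableT_comp => //; exact: measurable_aut_inv.
have pT A : measurable A -> (nu \x m) (T @^-1` A) = (nu \x m) A.
  move=> mA; rewrite /= /product_measure1.
  rewrite -(integral_mpaut S (measurable_fun_xsection m mA)) => [|y];
    last exact: measure_ge0.
  have mTA : measurable (T @^-1` A).
    by rewrite -[X in measurable X]setTI; exact: mT.
  apply: eq_integral => y _ /=.
  rewrite -(aut_preserving (a y) (measurable_xsection (S y) mA)).
  apply: ae_eq_measure.
  - exact: measurable_xsection.
  - by apply: measurable_mpaut_preimage; exact: measurable_xsection.
  by apply: filterS (Phia y) => t h; rewrite !xsectionE /= /T h.
exists (MpAut TK T'K mT mT' pT) => y.
by apply: filterS (Phia y) => t h; rewrite /= /T h.
Qed.

Lemma cocycle_slice_measurable (alpha : Co S) :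
  slice_measurable (fun y => repr (alpha y)).
Proof.
move=> D J mD mJ; apply: (measurableT_comp (measurable_mAut_meet mD mJ)).
exact: measurable_funPT.
Qed.

(** The choice operator in the definition of the skew product never falls back
on its default value. *)
Lemma skew_productP (alpha : Co S) : skew_lift S alpha (skew_product S alpha).
Proof.
apply: getPex; have [T hT] := skew_aut (cocycle_slice_measurable alpha).
exists (\pi T)%qT.
have := repr_mAut T; move/ae_prod; apply: filterS => y hy.
by apply: filterS2 hy (hT y) => t /(_ Logic.I) -> ->.
Qed.

End lift.

(** * Iterates of an automorphism and running minima *)

Section iterates.
Context d (T : measurableType d) (R : realType).
Variable mu : {measure set T -> \bar R}.

Lemma iter_mpaut (f : mpaut mu) n : exists g : mpaut mu, aut_fun g = iter n f.
Proof.
elim: n => [|n [g gE]]; first by exists (mpaut_id mu).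
by exists (mpaut_comp f g); apply/funext => x /=; rewrite gE.
Qed.

Lemma measurable_iter_mpaut (f : mpaut mu) n : measurable_fun setT (iter n f).
Proof. by have [g <-] := iter_mpaut f n; exact: measurable_aut. Qed.

Lemma iter_mpaut_preserving (f : mpaut mu) n A :
  measurable A -> mu (iter n f @^-1` A) = mu A.
Proof. by have [g <-] := iter_mpaut f n; exact: aut_preserving. Qed.

(** Continuity of f |-> f ^ n.  The symmetric difference of the preimages of E
under g ^ (n + 1) and f ^ (n + 1) splits into the preimage under g ^ n of
the symmetric difference for one step, whose measure does not depend on n,
and the symmetric difference for n steps with E replaced by its preimage
under f. *)
Lemma near_iter_dist n E (f : mAut mu) (e : R) : measurable E -> (0 < e)%R ->
  \forall g \near f,
    mu (iter n (repr (g : mAut mu)) @^-1` E `+` iter n (repr f) @^-1` E) < e%:E.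
Proof.
have mi (g : mAut mu) k A :
    measurable A -> measurable (iter k (repr g) @^-1` A).
  by move=> mA; rewrite -[X in measurable X]setTI; exact: measurable_iter_mpaut.
elim: n E e => [|n IH] E e mE e0.
  by apply: filterE => g /=; rewrite setYK measure0 lte_fin.
have e2 : (0 < e / 2)%R by rewrite divr_gt0.
have mfE := measurable_mpaut_preimage (repr f) mE.
apply: filterS2 (near_mAut_dist f mE e2) (IH _ _ mfE e2) => g h1 h2.
have mgE := measurable_mpaut_preimage (repr g) mE.
rewrite (splitr e) EFinD; apply: le_lt_trans (lteD h1 h2).
rewrite /mAut_dist.
rewrite -(iter_mpaut_preserving (repr g) n (measurable_setY mgE mfE)).
apply: le_trans (measureU2 _ _ _) => //.
- apply: le_measure; rewrite ?inE.
  + by apply: measurable_setY; exact: (mi _ n.+1).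
  + apply: measurableU; first by apply: mi; exact: measurable_setY.
    by apply: measurable_setY; exact: mi.
  + move=> x; rewrite /setY/=.
    by have [] := pselect (E (repr f (iter n (repr g) x))); tauto.
- by apply: mi; exact: measurable_setY.
- by apply: measurable_setY => //; exact: mi.
Qed.

End iterates.

Section small.
Context {T : Type} {R : realType} (F : set_system T) {FF : Filter F}.

Lemma near_sum_lt n (w : nat -> T -> \bar R) :
  (forall k (e : R), (0 < e)%R -> \forall g \near F, w k g < e%:E) ->
  forall e : R, (0 < e)%R -> \forall g \near F, \sum_(k < n) w k g < e%:E.
Proof.
move=> hw; elim: n => [|n IH] e e0.
  by apply: nearW => g; rewrite big_ord0 lte_fin.
have e2 : (0 < e / 2)%R by rewrite divr_gt0.
apply: filterS2 (IH _ e2) (hw n _ e2) => g h1 h2.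
by rewrite big_ord_recr/= (splitr e) EFinD; exact: lteD.
Qed.

End small.

Section running_min.
Context {T : Type} {R : realType}.
Implicit Type u : nat -> T -> \bar R.

(** The minimum of u N, ..., u (N + p - 1), capped at 1; the functions of
interest are measures of sets in a probability space. *)
Fixpoint running_min u N p x : \bar R :=
  if p is q.+1 then Order.min (running_min u N q x) (u (N + q)%N x) else 1.

Lemma running_min_ge0 u N p x :
  (forall n, 0 <= u n x) -> 0 <= running_min u N p x.
Proof.
by move=> u0; elim: p => [|p IH]; rewrite /= ?lee_fin// le_min IH u0.
Qed.

Lemma running_min_le1 u N p x : running_min u N p x <= 1.
Proof. by elim: p => [|p IH]; rewrite /= ?lexx// ge_min IH. Qed.

Lemma running_min_le u N p q x : (q < p)%N ->
  running_min u N p x <= u (N + q)%N x.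
Proof.
elim: p => // p IH; rewrite ltnS leq_eqVlt => /predU1P[->|/IH h].
  by rewrite /= ge_min lexx orbT.
by rewrite /= ge_min h.
Qed.

Lemma running_min_lt u N p x e : running_min u N p x < e -> e <= 1 ->
  exists2 n, (N <= n)%N & u n x < e.
Proof.
elim: p => [|p IH] /=; first by move=> /lt_le_trans /[apply]; rewrite ltxx.
rewrite gt_min => /orP[/IH//|h] _.
by exists (N + p)%N => //; exact: leq_addr.
Qed.

Lemma running_min_lipschitz u u' w N p x : (forall n, 0 <= w n x) ->
  (forall n, u' n x <= u n x + w n x) ->
  running_min u' N p x <= running_min u N p x + \sum_(q < p) w (N + q)%N x.
Proof.
move=> w0 uw; elim: p => [|p IH]; first by rewrite big_ord0 /= adde0.
rewrite big_ord_recr/= [X in _ <= X + _]minElt; case: ifP => _.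
  by rewrite ge_min (le_trans IH)// leeD2l// leeDl.
rewrite ge_min (le_trans (uw _)) ?orbT// leeD2l// leeDr//.
by apply: sume_ge0 => q _.
Qed.

End running_min.

Section running_min_integral.
Context d (T : measurableType d) (R : realType) (mu : probability T R).
Variable u : nat -> T -> \bar R.
Hypothesis mu_ : forall n, measurable_fun setT (u n).
Hypothesis u0 : forall n x, 0 <= u n x.

Lemma measurable_running_min N p : measurable_fun setT (running_min u N p).
Proof.
elim: p => [|p IH]; first exact: measurable_cst.
exact: measurable_mine.
Qed.

(** The limit of the running minima is the capped infimum of u over n >= N, and
a nonnegative function vanishes almost everywhere when its integral does;
the converse is bounded convergence. *)
Lemma running_min_integralP N :
  (forall k, exists p, \int[mu]_x running_min u N p x < (k.+1%:R^-1)%:E) <->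
  {ae mu, forall x, forall e : R, (0 < e)%R ->
     exists2 n, (N <= n)%N & u n x < e%:E}.
Proof.
split=> [h|h k].
  pose L x := einfs (running_min u N ^~ x) 0%N.
  have Lle p x : L x <= running_min u N p x.
    by apply: ereal_inf_lbound; exists p.
  have L0 x : 0 <= L x.
    by apply: le_ereal_inf_tmp => _ [p _ <-]; exact: running_min_ge0.
  have mL : measurable_fun setT L.
    by apply: measurable_fun_einfs => p; exact: measurable_running_min.
  have : \int[mu]_x L x = 0.
    apply/le_anti/andP; split; last exact: integral_ge0.
    apply/lee_addgt0Pr => e e0; rewrite add0e.
    have [k ke] : exists k, (k.+1%:R^-1 < e)%R.
      exists (Num.truncn e^-1); rewrite invf_plt ?posrE//.
      exact: truncnS_gt.
    have [p hp] := h k.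
    apply: (@le_trans _ _ (\int[mu]_x running_min u N p x)).
      by apply: ge0_le_integral => //; exact: measurable_running_min.
    by rewrite ltW// (lt_trans hp)// lte_fin.
  have -> : \int[mu]_x L x = \int[mu]_x `|L x|.
    by apply: eq_integral => x _; rewrite gee0_abs.
  move=> /(ae_eq_integral_abs _ measurableT mL).
  apply: filterS => x /(_ Logic.I) Lx.
  (* A running minimum below e only yields a small term when e <= 1, because of
     the cap. *)
  move=> e e0; pose e' := Num.min e 1%R.
  have : L x < e'%:E by rewrite Lx lte_fin lt_min e0 ltr01.
  have e'1 : e'%:E <= 1 by rewrite lee_fin ge_min lexx orbT.
  move=> /ereal_inf_lt[_ [p _ <-]] rp; have [n Nn un] := running_min_lt rp e'1.
  by exists n => //; rewrite (lt_le_trans un)// lee_fin ge_min lexx.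
have := @bounded_integral_cvg0 _ _ _ mu (running_min u N)
  (measurable_running_min N).
have b p x : 0 <= running_min u N p x <= 1.
  by rewrite running_min_ge0// running_min_le1.
move=> /(_ b) c.
have : \int[mu]_x running_min u N p x @[p --> \oo] --> 0.
  apply: c; apply: filterS h => x hx.
  apply/fine_cvgP; split.
    apply: nearW => p; rewrite ge0_fin_numE ?running_min_ge0//.
    by rewrite (le_lt_trans (running_min_le1 _ _ _ _))// ltry.
  apply/cvgr0Pnorm_lt => e e0; have [n Nn un] := hx e e0.
  exists (n - N).+1 => // p /= np.
  rewrite ger0_norm ?fine_ge0 ?running_min_ge0// -lte_fin fineK; last first.
    rewrite ge0_fin_numE ?running_min_ge0//.
    by rewrite (le_lt_trans (running_min_le1 _ _ _ _))// ltry.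
  apply: le_lt_trans un.
  by rewrite -(subnKC Nn); exact: running_min_le.
have k0 : nbhs (0 : \bar R) [set x | x < (k.+1%:R^-1)%:E].
  apply: open_nbhs_nbhs; split; first exact: open_ereal_lt_ereal.
  by rewrite /= lte_fin invr_gt0.
by move=> /(_ _ k0)[p _ /(_ p (leqnn p))]; exists p.
Qed.

End running_min_integral.

(** * The rigid cocycles form a G-delta set *)

(** Used to extract a subsequence along which the j-th requirement holds at the
j-th term. *)
Lemma increasing_choice (P : nat -> nat -> Prop) :
  (forall j N, exists2 n, (N <= n)%N & P j n) ->
  exists n : nat -> nat, (forall i j, (i < j)%N -> (n i < n j)%N) /\
    forall j, P j (n j).
Proof.
move=> h; pose s j N := sval (cid2 (h j N)).
have sP j N : (N <= s j N)%N /\ P j (s j N) by rewrite /s; case: cid2.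
pose n := fix n j := if j is i.+1 then s j (n i).+1 else s 0%N 0%N.
exists n; split; last first.
  by case=> [|j]; [exact: (sP 0%N 0%N).2|exact: (sP j.+1 (n j).+1).2].
have nS i : (n i < n i.+1)%N by exact: (sP i.+1 (n i).+1).1.
move=> i; elim=> // i' IH; rewrite ltnS leq_eqVlt => /predU1P[->//|/IH].
by move/ltn_trans; apply.
Qed.

Section cell_neq_bound.
Context d (T : measurableType d) (R : realType).
Variable mu : {measure set T -> \bar R}.

(** The weak topology only sees preimages of single sets; this is how it
controls cell mismatches. *)
Lemma measure_cell_neq_le (f g : T -> unitI R) j :
  measurable_fun setT f -> measurable_fun setT g ->
  mu [set x | cell j (f x) <> cell j (g x)] <= \sum_(k < (2 ^ j).+1)
    mu (f @^-1` (cell j @^-1` [set (k : nat)]) `+`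
        g @^-1` (cell j @^-1` [set (k : nat)])).
Proof.
move=> mf mg.
have mh (h : T -> unitI R) k : measurable_fun setT h ->
    measurable (h @^-1` (cell j @^-1` [set k])).
  move=> mh; rewrite -[X in measurable X]setTI; apply: mh => //.
  exact: measurable_cell_preimage.
pose A k := f @^-1` (cell j @^-1` [set k]) `+` g @^-1` (cell j @^-1` [set k]).
have mA k : measurable (A k) by apply: measurable_setY; exact: mh.
apply: le_trans (Boole_inequality mu (fun i _ => mA i)).
apply: le_measure; rewrite ?inE.
- exact: measurable_cell_neq.
- exact: bigsetU_measurable.
move=> x /= fg; rewrite -bigcup_mkord; exists (cell j (f x)) => /=.
  exact: cell_lt.
by left; split => //= /esym.
Qed.

End cell_neq_bound.

Section near_cell.
Context {R : realType}.
Notation m := (mI R).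

Lemma near_cell_dist j (f : mAut m) (e : R) : (0 < e)%R ->
  \forall g \near f, cell_dist j (repr (g : mAut m)) (repr f) < e%:E.
Proof.
move=> e0.
have h k (e' : R) : (0 < e')%R ->
    \forall g \near f, mAut_dist (cell j @^-1` [set k]) g f < e'%:E.
  by apply: near_mAut_dist; exact: measurable_cell_preimage.
apply: filterS (near_sum_lt (2 ^ j).+1 h e0) => g; apply: le_lt_trans.
by apply: measure_cell_neq_le; exact: measurable_aut.
Qed.

End near_cell.

Section rigid_Gdelta.
Context d (Y : measurableType d) (R : realType).
Notation m := (mI R).
Variables (nu : probability Y R) (S : mpaut nu).
Local Notation mAutX := (mAut (nu \x m)).
Implicit Types (alpha beta : Co S).

Lemma repr_mAut1 : {ae m, forall t, repr (1%g : mAut m) t = t}.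
Proof. by apply: filterS (repr_mAut (mpaut_id m)) => t /(_ Logic.I). Qed.

Lemma repr_mAutM (f g : mAut m) :
  {ae m, forall t, repr (f * g)%g t = repr f (repr g t)}.
Proof.
by apply: filterS (repr_mAut (mpaut_comp (repr f) (repr g))) => t /(_ Logic.I).
Qed.

(** Transfers questions about alpha_n to the powers of the single automorphism
T_alpha. *)
Lemma skew_iter alpha : {ae nu, forall y, forall n, {ae m, forall t,
  iter n (repr (skew_product S alpha)) (y, t) =
  (iter n S y, repr (Co_iter alpha n y) t)}}.
Proof.
apply: filterS (ae_iter_mpaut S (skew_productP alpha)) => y hy.
elim=> [|n IH] /=; first by apply: filterS repr_mAut1 => t /= ->.
apply: filterS3 IH (ae_comp_mpaut (repr (Co_iter alpha n y)) (hy n))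
  (repr_mAutM (alpha (iter n S y)) (Co_iter alpha n y)).
by move=> t -> /= -> ->.
Qed.

(** The level-j distance from alpha_n(y) to the identity, read off from the skew
product in order to be measurable in y; see [displacementE]. *)
Definition displacement alpha j n (y : Y) : \bar R :=
  m (xsection [set z |
    cell j (iter n (repr (skew_product S alpha)) z).2 <> cell j z.2] y).

Lemma measurable_cell_iter_neq (f g : mpaut (nu \x m)) j n k :
  measurable [set z | cell j (iter n f z).2 <> cell j (iter k g z).2].
Proof.
by apply: measurable_cell_neq; (apply: measurableT_comp;
  [exact: measurable_snd|exact: measurable_iter_mpaut]).
Qed.

Lemma measurable_displacement alpha j n :
  measurable_fun setT (displacement alpha j n).
Proof.
pose T := repr (skew_product S alpha).
exact: (measurable_fun_xsection m (measurable_cell_iter_neq T T j n 0%N)).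
Qed.

Lemma displacement_ge0 alpha j n y : 0 <= displacement alpha j n y.
Proof. exact: measure_ge0. Qed.

Lemma displacementE alpha : {ae nu, forall y, forall j n,
  displacement alpha j n y =
  cell_dist j (repr (Co_iter alpha n y)) (repr (1%g : mAut m))}.
Proof.
apply: filterS (skew_iter alpha) => y hy j n.
apply: ae_eq_measure.
- pose T := repr (skew_product S alpha).
  exact: (measurable_xsection y (measurable_cell_iter_neq T T j n 0%N)).
- by apply: measurable_cell_neq; exact: measurable_aut.
by apply: filterS2 (hy n) repr_mAut1 => t h h1; rewrite xsectionE/= h h1.
Qed.

Definition recurrent_within j N k : set (Co S) := [set alpha | exists p,
  \int[nu]_y running_min (displacement alpha j) N p y < (k.+1%:R^-1)%:E].

Lemma near_displacement alpha j n (e : R) : (0 < e)%R ->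
  \forall beta \near alpha, (nu \x m) [set z |
    cell j (iter n (repr (skew_product S beta)) z).2 <>
    cell j (iter n (repr (skew_product S alpha)) z).2] < e%:E.
Proof.
move=> e0; set f := skew_product S alpha.
suff : \forall g \near f, (nu \x m) [set z |
    cell j (iter n (repr (g : mAutX)) z).2 <>
    cell j (iter n (repr f) z).2] < e%:E.
  exact: (@initial_continuous _ _ (skew_product S) alpha).
have h k (e' : R) : (0 < e')%R -> \forall g \near f, (nu \x m)
    (iter n (repr (g : mAutX)) @^-1` (snd @^-1` (cell j @^-1` [set k])) `+`
     iter n (repr f) @^-1` (snd @^-1` (cell j @^-1` [set k]))) < e'%:E.
  apply: near_iter_dist; rewrite -[X in measurable X]setTI.
  by apply: measurable_snd => //; exact: measurable_cell_preimage.
apply: filterS (near_sum_lt (2 ^ j).+1 h e0) => g; apply: le_lt_trans.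
by apply: measure_cell_neq_le; (apply: measurableT_comp;
  [exact: measurable_snd|exact: measurable_iter_mpaut]).
Qed.

(** A perturbation of alpha changes the running minimum at y by at most the sum
over the finitely many n involved of the measure of the t where the n-th
powers of the two skew products disagree at level j.  Integrated over y,
this sum is small near alpha because taking powers is continuous. *)
Lemma open_recurrent_within j N k : open (recurrent_within j N k).
Proof.
rewrite openE => alpha [p hp].
pose c : R := (k.+1%:R^-1)%R.
pose v beta := \int[nu]_y running_min (displacement beta j) N p y.
have mv beta : measurable_fun setT (running_min (displacement beta j) N p).
  by apply: measurable_running_min => n; exact: measurable_displacement.
have vfin : v alpha \is a fin_num.
  rewrite ge0_fin_numE; last first.
    apply: integral_ge0 => y _; apply: running_min_ge0 => n.
    exact: displacement_ge0.
  by rewrite (lt_trans hp)// ltry.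
pose e := (c - fine (v alpha))%R.
have e0 : (0 < e)%R by rewrite subr_gt0 -lte_fin fineK.
pose D beta n := [set z | cell j (iter n (repr (skew_product S beta)) z).2 <>
    cell j (iter n (repr (skew_product S alpha)) z).2].
have mD beta n : measurable (D beta n) by exact: measurable_cell_iter_neq.
have h q (e' : R) : (0 < e')%R ->
    \forall beta \near alpha, (nu \x m) (D beta (N + q)%N) < e'%:E.
  exact: near_displacement.
apply: filterS (near_sum_lt p h e0) => beta hb; exists p.
have mw n : measurable_fun setT (fun y => m (xsection (D beta n) y)).
  exact: (measurable_fun_xsection m).
have dle n y : displacement beta j n y <=
    displacement alpha j n y + m (xsection (D beta n) y).
  pose Tb := repr (skew_product S beta); pose Ta := repr (skew_product S alpha).
  have mb := measurable_cell_iter_neq Tb Tb j n 0%N.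
  have ma := measurable_cell_iter_neq Ta Ta j n 0%N.
  apply: le_trans (measureU2 _ _ _); rewrite ?xsectionE.
  - apply: le_measure; rewrite ?inE -?xsectionE.
    + exact: measurable_xsection mb.
    + apply: measurableU; first exact: measurable_xsection ma.
      exact: measurable_xsection.
    + rewrite !xsectionE => t /= tb.
      have [ta|ta] := pselect (cell j (iter n Ta (y, t)).2 = cell j t);
        last by left.
      by right; rewrite /D /= -/Ta ta.
  - by rewrite -xsectionE; exact: measurable_xsection ma.
  - by rewrite -xsectionE; exact: measurable_xsection.
have : v beta <= v alpha + \sum_(q < p) (nu \x m) (D beta (N + q)%N).
  rewrite -ge0_integral_sum//; last by move=> q; exact: mw.
  rewrite -ge0_integralD//; last 3 first.
  - by move=> y _; apply: running_min_ge0 => n; exact: displacement_ge0.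
  - by move=> y _; apply: sume_ge0.
  - by apply: emeasurable_sum => q; exact: mw.
  apply: ge0_le_integral => //.
  - by move=> y _; apply: running_min_ge0 => n; exact: displacement_ge0.
  - by apply: emeasurable_funD => //; apply: emeasurable_sum => q; exact: mw.
  move=> y _.
  exact: (@running_min_lipschitz _ _ _ _
    (fun n y => m (xsection (D beta n) y))).
move=> /le_lt_trans; apply.
rewrite -(fineK vfin) (_ : k.+1%:R^-1 = fine (v alpha) + e)%R.
  by rewrite EFinD lteD2lE.
by rewrite /e /c addrC subrK.
Qed.

(** From returns at every level j, with arbitrarily small error and arbitrarily
late, a subsequence is extracted whose j-th term has level-j error below 1 /
(j + 1).  The distance grows with the level, so the error of that term is
also below 1 / (j + 1) at every level before j, and the subsequence
converges. *)
Lemma rigidP : [set alpha : Co S | rigid alpha] =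
  \bigcap_j \bigcap_N \bigcap_k recurrent_within j N k.
Proof.
apply/seteqP; split => alpha.
  move=> ra j _ N _ k _.
  have [_ h] := running_min_integralP nu (measurable_displacement alpha j)
    (displacement_ge0 alpha j) N.
  apply: h => {k}.
  apply: filterS2 ra (displacementE alpha) => y [n [nlt ncvg]] dE e e0.
  have [i0 _ hi] := ncvg _ (near_cell_dist j (1%g : mAut m) e0).
  exists (n (maxn i0 N)); last by rewrite dE; apply: hi; exact: leq_maxl.
  have nge i : (i <= n i)%N.
    by elim: i => // i IH; exact: leq_ltn_trans IH (nlt _ _ (ltnSn i)).
  exact: leq_trans (leq_maxr _ _) (nge _).
move=> ra.
have {}ra : {ae nu, forall y, forall j N, forall e : R, (0 < e)%R ->
    exists2 n, (N <= n)%N & displacement alpha j n y < e%:E}.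
  apply: ae_foralln => j; apply: ae_foralln => N.
  apply: (proj1 (running_min_integralP nu (measurable_displacement alpha j)
    (displacement_ge0 alpha j) N)) => k.
  exact: ra.
rewrite /= /rigid; apply: filterS2 ra (displacementE alpha) => y hy dE.
have [|n [nlt nP]] := @increasing_choice (fun j n =>
    displacement alpha j n y < (j.+1%:R^-1)%:E).
  by move=> j N; apply: hy; rewrite invr_gt0.
exists n; split => //.
apply: weak_cvg_cell_dist => j.
apply/fine_cvgP; split.
  apply: nearW => i; apply: fin_num_measure.
  by apply: measurable_cell_neq; exact: measurable_aut.
apply/cvgr0Pnorm_lt => e e0.
exists (maxn j (Num.truncn e^-1)) => // i /=; rewrite geq_max => /andP[ji ie].
rewrite ger0_norm ?fine_ge0 ?measure_ge0// -lte_fin fineK; last first.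
  apply: fin_num_measure.
  by apply: measurable_cell_neq; exact: measurable_aut.
apply: (@le_lt_trans _ _ (displacement alpha i (n i) y)).
  by rewrite dE; apply: cell_dist_mono => //; exact: measurable_aut.
apply: (lt_le_trans (nP i)); rewrite lee_fin.
rewrite invf_ple ?posrE// (le_trans (ltW (truncnS_gt _)))//.
by rewrite ler_nat.
Qed.

Lemma rigid_Gdelta : Gdelta [set alpha : Co S | rigid alpha].
Proof.
exists (fun i => if (unpickle i : option (nat * nat * nat)) is Some (j, N, k)
  then recurrent_within j N k else setT).
  move=> i; case: (unpickle i) => [[[j N] k]|]; last exact: openT.
  exact: open_recurrent_within.
rewrite rigidP; apply/seteqP; split=> [alpha h i _|alpha h j _ N _ k _].
  by case: (unpickle i) => [[[j N] k]|//]; exact: h.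
by have := h (pickle (j, N, k)) Logic.I; rewrite pickleK.
Qed.

End rigid_Gdelta.

(** * Permutations of the cells *)

Section perm_match.
Context (T : finType) (L : eqType).
Local Open Scope set_scope.
Implicit Types (l : T -> L) (s : {perm T}).

(** Take s with the fewest mismatches.  If x were a mismatch with wanted label i
and x' another mismatch whose image has label i, exchanging the images of x
and x' would do better.  So as soon as label i has a mismatch, all points
whose image has label i wanted it: the supply of i is exhausted and the
mismatches of i are exactly the excess of demand over supply. *)
Lemma perm_match (l0 l1 : T -> L) : exists s : {perm T}, forall i,
  (#|[set x | (l0 x == i) && (l1 (s x) != i)]| <=
   #|[set x | l0 x == i]| - #|[set x | l1 x == i]|)%N.
Proof.
pose bad s := [set x | l1 (s x) != l0 x].
have [s _ smin] := @arg_minnP _ (1%g : {perm T}) predT (fun s => #|bad s|) isT.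
have good x x' : x \in bad s -> l1 (s x') = l0 x -> l0 x' = l0 x.
  rewrite inE => badx sx'; apply/eqP; apply: contraT => nx'.
  have xx' : x' != x by apply: contraNneq badx => xx'; rewrite -sx' xx'.
  pose s' := (tperm x x' * s)%g.
  have : (#|bad s'| < #|bad s|)%N.
    apply: proper_card; apply/properP; split.
      apply/fintype.subsetP => y; rewrite !inE permM.
      case: tpermP => [->|->|//]; first by rewrite sx' eqxx.
      by move=> _; rewrite sx' eq_sym.
    by exists x; rewrite ?inE// permM tpermL sx' eqxx.
  by rewrite ltnNge smin.
exists s => i; set B := [set x | _ & _].
have [->|[x0]] := set_0Vmem B; first by rewrite cards0.
rewrite inE => /andP[/eqP x0i sx0].
have x0bad : x0 \in bad s by rewrite inE x0i.
pose C := [set x | (l0 x == i) && (l1 (s x) == i)].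
have -> : [set x | l0 x == i] = B :|: C.
  by apply/setP => x; rewrite !inE; case: (l0 x == i); rewrite // orNb.
have <- : #|C| = #|[set x | l1 x == i]|.
  rewrite -(card_preimset [set x | l1 x == i] (@perm_inj _ s)).
  apply: eq_card => x; rewrite !inE andbC; case: eqP => //= h.
  by rewrite (good x0 x)// ?x0i ?eqxx// h.
rewrite cardsU (_ : B :&: C = finset.set0) ?cards0 ?subn0 ?addnK//.
by apply/setP => x; rewrite !inE; case: (l1 (s x) == i); rewrite /= ?andbF.
Qed.

End perm_match.

Section shuffle.
Context {R : realType}.
Notation UI := (unitI R).
Notation m := (mI R).

Lemma lebesgue_measure_shift (c : R) (A : set (measurableTypeR R)) :
  measurable A ->
  lebesgue_measure ((fun x : measurableTypeR R => (x + c)%R) @^-1` A) =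
  lebesgue_measure A.
Proof.
move=> mA; have mc : measurable_fun setT
  ((fun x => (x + c)%R) : measurableTypeR R -> measurableTypeR R).
  exact: measurable_funD.
suff : lebesgue_measure A = pushforward lebesgue_measure
  ((fun x => (x + c)%R) : measurableTypeR R -> measurableTypeR R) A by [].
apply: lebesgue_measure_unique => // _ [[a b]] _ <-.
rewrite /= /pushforward [X in _ = lebesgue_measure X](_ : _ =
    `](a - c)%R, (b - c)%R]%classic); last first.
  by apply/seteqP; split=> x /=; rewrite !in_itv/= ltrBlDr lerBrDr.
rewrite !lebesgue_measure_itv/= !lte_fin ltrD2r.
by case: ifP => // _; rewrite -!EFinB; congr (_%:E); ring.
Qed.

Lemma mI_cell_sum M (B : set UI) : measurable B ->
  m B = \sum_(k < (2 ^ M).+1) m (B `&` cell M @^-1` [set (k : nat)]).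
Proof.
move=> mB.
rewrite -(@measure_bigsetU _ _ _ m (fun k => B `&` cell M @^-1` [set k])).
- congr (m _).
  rewrite -(bigcup_mkord _ (fun k => B `&` cell M @^-1` [set k])).
  apply/seteqP; split=> [t Bt|t [k _ []]]//.
  by exists (cell M t) => //=; exact: cell_lt.
- by move=> k; apply: measurableI => //; exact: measurable_cell_preimage.
- apply/trivIsetP => i j _ _ ij; apply/seteqP; split => // t.
  by move=> [[_ /= ti] [_ /= tj]]; move: ij; rewrite -ti -tj eqxx.
Qed.

Variable M : nat.
Implicit Types (s : 'S_(2 ^ M)) (t : UI) (k : nat).

Definition nat_perm s k : nat := if insub k is Some i then s i else k.

Lemma nat_permE s (i : 'I_(2 ^ M)) : nat_perm s i = s i.
Proof. by rewrite /nat_perm valK. Qed.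

Lemma nat_perm_ge s k : (2 ^ M <= k)%N -> nat_perm s k = k.
Proof. by move=> h; rewrite /nat_perm insubN// -leqNgt. Qed.

Lemma nat_perm1 k : nat_perm 1%g k = k.
Proof.
have [kM|kM] := ltnP k (2 ^ M); last by rewrite nat_perm_ge.
by rewrite -[k]/(nat_of_ord (Ordinal kM)) nat_permE perm1.
Qed.

Lemma nat_permM s1 s2 k : nat_perm (s1 * s2)%g k = nat_perm s2 (nat_perm s1 k).
Proof.
have [kM|kM] := ltnP k (2 ^ M); last by rewrite !nat_perm_ge.
by rewrite -[k]/(nat_of_ord (Ordinal kM)) !nat_permE permM.
Qed.

Lemma shuffle_subproof s t : (unitI_val t +
  ((nat_perm s (cell M t))%:R - (cell M t)%:R) / 2 ^+ M)%R \in `[0%R, 1%R].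
Proof.
have p0 : (0 < 2 ^+ M :> R)%R by rewrite exprn_gt0.
have [kM|kM] := ltnP (cell M t) (2 ^ M); last first.
  by rewrite nat_perm_ge// subrr mul0r addr0 in_itv/= unitI_ge0 unitI_le1.
have /cellE/andP[tl tu] := erefl (cell M t).
have sM : (nat_perm s (cell M t) < 2 ^ M)%N.
  by rewrite -[cell M t]/(nat_of_ord (Ordinal kM)) nat_permE.
rewrite in_itv/= -(ler_pM2l p0) -[X in _ && X](ler_pM2l p0) mulr0 mulr1.
rewrite mulrDr mulrCA mulfV ?gt_eqF// mulr1 addrCA.
have sM' : ((nat_perm s (cell M t))%:R + 1 <= 2 ^+ M :> R)%R.
  by rewrite natr1 -natrX ler_nat.
have s0 : (0 <= (nat_perm s (cell M t))%:R :> R)%R by rewrite ler0n.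
rewrite -natr1 in tu.
by apply/andP; split; lra.
Qed.

Definition shuffle s t : UI :=
  @exist R (fun x : R => x \in `[0%R, 1%R]) _ (shuffle_subproof s t).

Lemma cell_shuffle s t : cell M (shuffle s t) = nat_perm s (cell M t).
Proof.
have p0 : (0 < 2 ^+ M :> R)%R by rewrite exprn_gt0.
have /cellE/andP[tl tu] := erefl (cell M t).
apply/cellE; rewrite {2}/unitI_val /= mulrDr mulrCA mulfV ?gt_eqF// mulr1.
by rewrite -natr1 in tu; rewrite -natr1; apply/andP; split; lra.
Qed.

Lemma shuffle1 t : shuffle 1%g t = t.
Proof.
by apply: unitI_val_inj; rewrite /unitI_val/= nat_perm1 subrr mul0r addr0.
Qed.

Lemma shuffleM s1 s2 t : shuffle (s1 * s2)%g t = shuffle s2 (shuffle s1 t).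
Proof.
apply: unitI_val_inj; rewrite /unitI_val/= cell_shuffle nat_permM.
by rewrite -addrA -mulrDl; congr (_ + _ / _)%R; ring.
Qed.

Lemma shuffleK s : cancel (shuffle s) (shuffle s^-1%g).
Proof. by move=> t; rewrite -shuffleM mulgV shuffle1. Qed.

Lemma shuffleVK s : cancel (shuffle s^-1%g) (shuffle s).
Proof. by move=> t; rewrite -shuffleM mulVg shuffle1. Qed.

Lemma measurable_shuffle s : measurable_fun setT (shuffle s).
Proof.
apply: measurable_unitI_fun; rewrite /unitI_val/=.
apply: measurable_funD; first exact: measurable_unitI_val.
exact: (measurableT_comp (_ : measurable_fun setT
  (fun k : nat => ((nat_perm s k)%:R - k%:R) / 2 ^+ M : R)%R)
  (@measurable_cell R M)).
Qed.

(** On each cell the map is a translation, and s permutes the cells. *)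
Lemma shuffle_preserving s A : measurable A -> m (shuffle s @^-1` A) = m A.
Proof.
move=> mA.
have msA : measurable (shuffle s @^-1` A).
  by rewrite -[X in measurable X]setTI; exact: measurable_shuffle.
have translate k : m (shuffle s @^-1` A `&` cell M @^-1` [set k]) =
    m (A `&` cell M @^-1` [set nat_perm s k]).
  rewrite /mI -[RHS](lebesgue_measure_shift
    (((nat_perm s k)%:R - k%:R) / 2 ^+ M)%R); last first.
    apply: measurable_unitI_image; apply: measurableI => //.
    exact: measurable_cell_preimage.
  congr (lebesgue_measure _); apply/seteqP; split.
    move=> _ [t [/= At <-] <-]; exists (shuffle s t) => //; split => //=.
    exact: cell_shuffle.
  move=> x [t [/= At tk] tx]; exists (shuffle s^-1%g t).
    rewrite /= shuffleVK; split => //.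
    by rewrite cell_shuffle tk -nat_permM mulgV nat_perm1.
  apply: (addIr (((nat_perm s k)%:R - k%:R) / 2 ^+ M)%R).
  rewrite -tx /unitI_val/= tk -nat_permM mulgV nat_perm1.
  rewrite -addrA -mulrDl [X in (_ + X / _)%R](_ : _ = 0%R); last by ring.
  by rewrite mul0r addr0.
rewrite (mI_cell_sum M mA) (mI_cell_sum M msA) !big_ord_recr/=; congr (_ + _).
  rewrite [RHS](reindex_inj (@perm_inj _ s)); apply: eq_bigr => i _.
  by rewrite translate nat_permE.
by rewrite translate nat_perm_ge.
Qed.

Definition shuffle_aut s : mpaut m := MpAut (shuffleK s) (shuffleVK s)
  (measurable_shuffle s) (measurable_shuffle s^-1%g) (@shuffle_preserving s).

End shuffle.

(** * Weak approximation by permutations of the cells *)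

Section shuffle_dense.
Context {R : realType}.
Notation UI := (unitI R).
Notation m := (mI R).

Definition cells M (A : {set 'I_(2 ^ M)}) : set UI :=
  [set t | exists2 x, x \in A & cell M t = x :> nat].

Lemma measurable_cells M (A : {set 'I_(2 ^ M)}) : measurable (cells A).
Proof.
exact: (@measurable_cell_preimage R M
  [set k | exists2 x, x \in A & k = x :> nat]).
Qed.

Lemma mI_cells M (A : {set 'I_(2 ^ M)}) :
  m (cells A) = (#|A|%:R / 2 ^+ M)%:E.
Proof.
rewrite (mI_cell_sum M (measurable_cells A)) big_ord_recr/=.
rewrite (_ : _ `&` _ = set0); last first.
  by apply/seteqP; split => // t [[x _ /= ->] /= xM]; have := ltn_ord x;
    rewrite xM ltnn.
rewrite measure0 adde0 (eq_bigr (fun k => if k \in A then (2 ^- M)%:E else 0)).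
  rewrite -big_mkcond/= sumEFin sumr_const -[RHS]/(_ / _)%R%:E.
  by rewrite mulr_natl.
move=> k _; case: ifPn => kA.
  rewrite -(mI_cell (R := R) (ltn_ord k)); congr (m _).
  by apply/seteqP; split=> [t []//|t /= tk]; split => //; exists k.
rewrite (_ : _ `&` _ = set0) ?measure0//.
apply/seteqP; split => // t [[x xA /= ->] /= /val_inj xk].
by move: kA; rewrite -xk xA.
Qed.

(** Label each level-M cell by the level-n cell into which f sends most of it.
Demand for label i exceeds its supply 2 ^ (M - n) only because of points
with a wrong label, f being measure preserving, so a permutation that
matches the labels up to the excess is wrong on a set not larger than the
set E of mislabelled points. *)
Lemma shuffle_approx (f : mpaut m) n (e : R) : (0 < e)%R ->
  \forall M \near \oo, exists s : 'S_(2 ^ M), cell_dist n (shuffle s) f < e%:E.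
Proof.
move=> e0; have e2 : (0 < e / 2)%R by rewrite divr_gt0.
have mcf : measurable_fun setT (cell n \o f).
  by apply: measurableT_comp; [exact: measurable_cell|exact: measurable_aut].
have [l lcvg] := label_approx mcf.
have small : nbhs (0 : \bar R) [set x | x < (e / 2)%:E].
  apply: open_nbhs_nbhs; split; first exact: open_ereal_lt_ereal.
  by rewrite /= lte_fin.
have [M0 _ hM0] := lcvg _ small.
exists (maxn n M0) => // M /=; rewrite geq_max => /andP[nM M0M].
have {hM0 M0M} := hM0 M M0M; rewrite /= -/(cell n \o f).
set E := [set t | _ <> _] => Ee.
pose l0 (k : 'I_(2 ^ M)) := l M k.
pose l1 (k : 'I_(2 ^ M)) := (k %/ 2 ^ (M - n))%N.
have [s hs] := perm_match l0 l1; exists s.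
have mlM i : measurable [set t : UI | l M (cell M t) = i].
  exact: (@measurable_cell_preimage R M (l M @^-1` [set i])).
have mcn i : measurable [set t : UI | cell n (f t) = i].
  by rewrite -[X in measurable X]setTI; exact: (mcf measurableT [set i]).
pose W i := [set t : UI | l M (cell M t) = i] `\` [set t | cell n (f t) = i].
have EE : E = \bigcup_i W i.
  apply/seteqP; split=> [t tE|t [i _ [/= <- /nesym]]]//.
  by exists (l M (cell M t)) => //; split => //= /esym.
have mW i : measurable (W i) by exact: measurableD.
have mE : measurable E by rewrite EE; exact: bigcup_measurable.
pose B i := [set x | (l0 x == i) && (l1 (s x) != i)]%SET.
have mB i : m (cells (B i)) <= m (W i).
  have [h|h] := leqP #|[set x | l0 x == i]%SET| #|[set x | l1 x == i]%SET|.
    have := hs i; rewrite (eqP h) leqn0 cards_eq0 => /eqP Bi.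
    rewrite (_ : cells _ = set0) ?measure0//.
    by apply/seteqP; split => // t [x]; rewrite /B Bi inE.
  have hi : ((#|B i| + #|[set x | l1 x == i]%SET|)%:R <=
      #|[set x | l0 x == i]%SET|%:R :> R)%R.
    by rewrite ler_nat addnC -leq_subRL ?(ltnW h)//; exact: hs.
  have c1 : m [set t | cell n (f t) = i] <= m (cells [set x | l1 x == i]%SET).
    rewrite (_ : [set t | _] = f @^-1` (cell n @^-1` [set i]))//.
    rewrite aut_preserving; last exact: measurable_cell_preimage.
    (* The point 1 is in no cell of index below 2 ^ M. *)
    rewrite -[leRHS]adde0 -(@mI_cell_ge R M (2 ^ M) (leqnn _)).
    have mc := @measurable_cell_preimage R M [set (2 ^ M)%N].
    have mi := measurable_cells [set x | l1 x == i]%SET.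
    apply: le_trans (measureU2 _ mi mc); apply: le_measure; rewrite ?inE.
    + exact: measurable_cell_preimage.
    + exact: measurableU.
    + move=> t /= ti; have := cell_lt M t.
      rewrite ltnS leq_eqVlt => /predU1P[|tM]; [by right|left].
      exists (Ordinal tM) => //; rewrite inE /l1 /=.
      by rewrite -(cell_mono t nM) ti.
  have c0 : m (cells [set x | l0 x == i]%SET) <=
      m (W i) + m [set t | cell n (f t) = i].
    apply: le_trans (measureU2 _ _ _) => //; apply: le_measure; rewrite ?inE.
    + exact: measurable_cells.
    + exact: measurableU.
    + move=> t [x]; rewrite inE => /eqP x0 tx.
      have [ti|ti] := pselect (cell n (f t) = i); [by right|left].
      by split => //=; rewrite tx.
  have := le_trans c0 (leeD2l _ c1).
  have : m (W i) \is a fin_num by exact: fin_num_measure.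
  rewrite !mI_cells; case: (m _) => // r _; rewrite -EFinD !lee_fin.
  rewrite natrD in hi.
  have p0 : (0 < (2 ^+ M)^-1 :> R)%R by rewrite invr_gt0 exprn_gt0.
  move: ((2 ^+ M)^-1)%R p0 => q q0 h1.
  have h2 := ler_wpM2r (ltW q0) hi; rewrite mulrDl in h2.
  by lra.
(* The sets W i are disjoint with union E, so summing over all labels costs
   nothing. *)
have mUB : m (\bigcup_i cells (B i)) <= m E.
  apply: le_trans (generalized_Boole_inequality m _ _) _.
  - by move=> i; exact: measurable_cells.
  - by apply: bigcup_measurable => i _; exact: measurable_cells.
  rewrite EE measure_bigcup//; last first.
    apply/trivIsetP => i j _ _ ij; apply/seteqP; split => // t.
    by move=> [[/= ti _] [/= tj _]]; move: ij; rewrite -ti -tj eqxx.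
  rewrite [leRHS](@eq_eseriesl _ _ xpredT); last by move=> i; rewrite in_setT.
  by apply: lee_nneseries => i _ //; exact: mB.
have mc := @measurable_cell_preimage R M [set (2 ^ M)%N].
have mUBm : measurable (\bigcup_i cells (B i)).
  by apply: bigcup_measurable => i _; exact: measurable_cells.
apply: (@le_lt_trans _ _ (m E + (m (\bigcup_i cells (B i)) +
                                 m (cell M @^-1` [set (2 ^ M)%N])))).
  apply: le_trans (leeD2l _ (measureU2 _ mUBm mc)).
  have mU := measurableU _ _ mUBm mc.
  apply: le_trans (measureU2 _ mE mU); apply: le_measure; rewrite ?inE.
  - by apply: measurable_cell_neq;
      [exact: measurable_shuffle|exact: measurable_aut].
  - exact: measurableU.
  move=> t /= st; have [tE|tE] := pselect (E t); [by left|right].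
  have {}tE : l M (cell M t) = cell n (f t) by apply: contrapT.
  have := cell_lt M t; rewrite ltnS leq_eqVlt => /predU1P[|tM]; [by right|left].
  exists (l M (cell M t)) => //; exists (Ordinal tM) => //.
  rewrite inE /l0/= eqxx/=; apply/eqP => h; apply: st.
  rewrite (cell_mono _ nM) cell_shuffle -tE -h /l1.
  by rewrite -[cell M t]/(nat_of_ord (Ordinal tM)) nat_permE.
rewrite mI_cell_ge// adde0 (splitr e) EFinD; apply: lteD => //.
exact: le_lt_trans mUB _.
Qed.

End shuffle_dense.

(** * Cocycles with values in a finite group are rigid *)

Section fibers.
Context d (Y : measurableType d) (G : finType).

Lemma measurable_finType_preimage (f : Y -> G) (B : set G) :
  (forall x, measurable (f @^-1` [set x])) -> measurable (f @^-1` B).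
Proof.
move=> mf; rewrite (_ : f @^-1` B = \bigcup_(x in B) f @^-1` [set x]).
  by apply: fin_bigcup_measurable => [|x _]; [exact: finite_finset|exact: mf].
by apply/seteqP; split=> [y By|y [x Bx /= ->]]; [exists (f y)|].
Qed.

Lemma measurable_ffun_fiber (I : finType) (f : Y -> {ffun I -> G}) :
  (forall i x, measurable [set y | f y i = x]) ->
  forall w, measurable (f @^-1` [set w]).
Proof.
move=> mf w; rewrite (_ : _ @^-1` _ = \bigcap_i [set y | f y i = w i]).
  by apply: fin_bigcap_measurable => [|i _]; [exact: finite_finset|exact: mf].
apply/seteqP; split=> [y /= yw i _|y h]; first by rewrite /= yw.
by apply/ffunP => i; exact: h.
Qed.

End fibers.

Section recurrence.
Context d (Y : measurableType d) (R : realType).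
Variables (nu : probability Y R) (S : mpaut nu) (G : finType).
Variable sigma : Y -> {perm G}.
Hypothesis msigma : forall s, measurable (sigma @^-1` [set s]).

(** Products in the permutation group compose from left to right, so the newest
factor is on the right. *)
Fixpoint perm_iter n y : {perm G} :=
  if n is k.+1 then (perm_iter k y * sigma (iter k S y))%g else 1%g.

Lemma perm_iterD n k y :
  perm_iter (n + k) y = (perm_iter n y * perm_iter k (iter n S y))%g.
Proof.
elim: k => [|k IH]; first by rewrite addn0 mulg1.
by rewrite addnS /= IH mulgA -iterD addnC.
Qed.

Lemma measurable_perm_iter n B : measurable (perm_iter n @^-1` B).
Proof.
apply: measurable_finType_preimage => {B}.
elim: n => [|n IH] s.
  have [->|s1] := eqVneq s 1%g.
    rewrite (_ : _ @^-1` _ = setT) //; exact/seteqP.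
  rewrite (_ : _ @^-1` _ = set0) //; apply/seteqP; split=> // y /= ys.
  by rewrite ys eqxx in s1.
rewrite (_ : _ @^-1` _ = \bigcup_s1 ((perm_iter n @^-1` [set s1]) `&`
    (iter n S @^-1` (sigma @^-1` [set (s1^-1 * s)%g])))).
  apply: fin_bigcup_measurable => [|s1 _]; first exact: finite_finset.
  apply: measurableI; first exact: IH.
  by rewrite -[X in measurable X]setTI; exact: measurable_iter_mpaut.
apply/seteqP; split=> [y /= <-|y [s1 _ [/= -> ->]]].
  by exists (perm_iter n y) => //; split => //=; rewrite mulKg.
by rewrite mulVKg.
Qed.

(** Let V be the set of points whose iterates return to 1 only finitely often.
By the cocycle identity the n-th point of the orbit of y lies in V only if
the value of the n-th iterate at y is taken finitely often; there are
finitely many values, so the orbit leaves V for good.  Thus the measures of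
the sets S ^ (-n) V tend to 0, but they all equal that of V. *)
Lemma perm_iter_recurrent :
  {ae nu, forall y, forall N, exists2 n, (N <= n)%N & perm_iter n y = 1%g}.
Proof.
pose V := ~` [set y | forall N, exists2 n, (N <= n)%N & perm_iter n y = 1%g].
have mV : measurable V.
  rewrite (_ : V = \bigcup_N \bigcap_(n in [set n | (N <= n)%N])
      (perm_iter n @^-1` (~` [set 1%g]))).
    apply: bigcup_measurable => N _; apply: bigcap_measurableType => n _.
    exact: measurable_perm_iter.
  apply/seteqP; split=> [y /existsNP[N hN]|y [N _ h] /(_ N)[n Nn]].
    by exists N => // n Nn ny; apply: hN; exists n.
  exact: h.
have Vfin y : \forall n \near \oo, ~ (iter n S @^-1` V) y.
  have stable g : exists N0, forall n, (N0 <= n)%N -> perm_iter n y = g ->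
      forall N, exists2 n', (N <= n')%N & perm_iter n' y = g.
    have [h|/existsNP[N0 h]] := pselect
      (forall N, exists2 n', (N <= n')%N & perm_iter n' y = g).
      by exists 0%N.
    by exists N0 => n Nn ng; exfalso; apply: h; exists n.
  pose N0 g := sval (cid (stable g)).
  exists (\max_g N0 g)%N => // n /= Nn; apply => N.
  have := svalP (cid (stable (perm_iter n y))).
  move=> /(_ n _ erefl (n + N)%N)[|n' nNn' n'n].
    exact: leq_trans (leq_bigmax _) Nn.
  have nn' : (n <= n')%N := leq_trans (leq_addr _ _) nNn'.
  exists (n' - n)%N; first by rewrite leq_subRL.
  have := perm_iterD n (n' - n) y; rewrite subnKC//.
  by rewrite n'n -{1}[perm_iter n y]mulg1 => /mulgI.
have mSV n : measurable (iter n S @^-1` V).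
  by rewrite -[X in measurable X]setTI; exact: measurable_iter_mpaut.
have : nu (iter n S @^-1` V) @[n --> \oo] --> 0.
  by apply: measure_cvg0 => //; exact: aeW.
rewrite (_ : (fun n => _) = cst (nu V)); last first.
  by apply/funext => n; rewrite iter_mpaut_preserving.
move=> /(cvg_unique _ (@cvg_cst _ _ _ _ _))-/(_ (@ereal_hausdorff R)) V0.
by exists V; split => // y /= h; exact: h.
Qed.

End recurrence.

Section shuffle_class.
Context {R : realType} (M : nat).
Notation m := (mI R).

Definition shuffle_class (s : 'S_(2 ^ M)) : mAut m := \pi%qT (shuffle_aut s).

Lemma shuffle_class1 : shuffle_class 1%g = 1%g.
Proof. by apply/mAutP; apply: aeW => t _ /=; exact: shuffle1. Qed.

Lemma shuffle_classM s1 s2 :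
  shuffle_class (s1 * s2)%g = (shuffle_class s2 * shuffle_class s1)%g.
Proof.
transitivity (mAut_mul (shuffle_class s2) (shuffle_class s1)) => //.
rewrite /shuffle_class mAut_mul_pi.
by apply/mAutP; apply: aeW => t _ /=; exact: shuffleM.
Qed.

Lemma cell_dist_class n (s : 'S_(2 ^ M)) (f : mpaut m) :
  cell_dist n (repr (shuffle_class s)) f = cell_dist n (shuffle s) f.
Proof.
apply: ae_eq_measure.
- by apply: measurable_cell_neq; exact: measurable_aut.
- by apply: measurable_cell_neq;
    [exact: measurable_shuffle|exact: measurable_aut].
by apply: filterS (repr_mAut (shuffle_aut s)) => t /(_ Logic.I) /= ->.
Qed.

End shuffle_class.

Section cocycles.
Context d (Y : measurableType d) (R : realType).
Notation m := (mI R).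
Variables (nu : probability Y R) (S : mpaut nu).

Lemma cocycle_of_fun (b : Y -> mAut m) : measurable_fun setT b ->
  exists beta : Co S, {ae nu, forall y, beta y = b y}.
Proof.
move=> mb; pose b_mixin := isMeasurableFun.Build _ _ _ _ b mb.
pose b_mfun : {mfun Y >-> mAut m} := HB.pack b b_mixin.
exists (\pi%qT b_mfun : {mfun_ nu, Y >-> mAut m}).
have /eqP := reprK (\pi%qT b_mfun : {mfun_ nu, Y >-> mAut m}).
rewrite eqmodE => /asboolP; apply: filterS => y /(_ Logic.I) h.
exact: h.
Qed.

Lemma shuffle_cocycle M (sigma : Y -> 'S_(2 ^ M)) :
  (forall s, measurable (sigma @^-1` [set s])) ->
  exists beta : Co S, {ae nu, forall y, beta y = shuffle_class (sigma y)} /\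
    rigid beta.
Proof.
move=> ms.
have [|beta hb] := @cocycle_of_fun (fun y => shuffle_class (sigma y)).
  move=> _ B _; rewrite setTI.
  exact: (measurable_finType_preimage (@shuffle_class R M @^-1` B) ms).
exists beta; split => //.
apply: filterS2 (perm_iter_recurrent S ms) (ae_iter_mpaut S hb) => y hr hby.
have iterE n : Co_iter beta n y = shuffle_class (perm_iter S sigma n y).
  elim: n => [|n IH] /=; first by rewrite shuffle_class1.
  by rewrite IH shuffle_classM; congr (_ * _)%g; exact: hby.
have [|n [nlt n1]] := @increasing_choice (fun _ n =>
    perm_iter S sigma n y = 1%g); first by move=> _ N; exact: hr.
exists n; split => //; apply: cvg_near_cst; apply: nearW => k.
by rewrite iterE n1 shuffle_class1.
Qed.

End cocycles.

(** * Measurable choice of a best permutation *)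

Section selection.
Context d (Y : measurableType d) (R : realType).
Notation m := (mI R).
Variable a : Y -> mpaut m.
Hypothesis sa : slice_measurable a.

Lemma measurable_cell_dist_slice n (f : mpaut m) :
  measurable_fun setT (fun y => cell_dist n f (a y)).
Proof.
pose C (k : nat) := cell n @^-1` [set k] : set (unitI R).
have mC k : measurable (C k) by exact: measurable_cell_preimage.
have mfC k := measurable_mpaut_preimage f (mC k).
have -> : (fun y => cell_dist n f (a y)) =
    (fun y => \sum_(k < (2 ^ n).+1) m (a y @^-1` (~` C k) `&` f @^-1` C k)).
  apply/funext => y.
  pose B k := a y @^-1` (~` C k) `&` f @^-1` C k.
  have mB k : measurable (B k).
    apply: measurableI => //; apply: measurable_mpaut_preimage.
    exact: measurableC.
  rewrite -(@measure_bigsetU _ _ _ m B)//; last first.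
    apply/trivIsetP => i j _ _ ij; apply/seteqP; split => // t.
    by move=> [[_ /= ti] [_ /= tj]]; move: ij; rewrite -ti -tj eqxx.
  congr (m _); rewrite -(bigcup_mkord _ B); apply/seteqP; split.
    move=> t /= ft; exists (cell n (f t)) => /=; first exact: cell_lt.
    by split => //= /esym.
  by move=> t [k _ [/= at_ tk]] => /esym; rewrite /= tk.
by apply: emeasurable_sum => k; apply: sa => //; exact: measurableC.
Qed.

(** One requirement for each level n, met with an error that shrinks with n, so
that counting how many are met measures the quality of a permutation. *)
Definition fits M (s : 'S_(2 ^ M)) n y : bool :=
  (cell_dist n (shuffle s) (a y) < (n.+1%:R^-1)%:E).

Definition best_shuffle M y : 'S_(2 ^ M) :=
  arg_max (1%g : 'S_(2 ^ M)) predT (fun s => \sum_(n < M) fits s n y)%N.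

(** The choice depends on y only through the finite table of truth values of
[fits]. *)
Lemma measurable_best_shuffle M s :
  measurable (@best_shuffle M @^-1` [set s]).
Proof.
pose profile y := [ffun sn : 'S_(2 ^ M) * 'I_M => fits sn.1 sn.2 y].
pose pick (w : {ffun 'S_(2 ^ M) * 'I_M -> bool}) : 'S_(2 ^ M) :=
  arg_max (1%g : 'S_(2 ^ M)) predT (fun s => \sum_(n < M) w (s, n))%N.
have -> : @best_shuffle M = pick \o profile.
  apply/funext => y /=; congr (arg_max _ _ _); apply/funext => s'.
  by apply: eq_bigr => n _; rewrite ffunE.
rewrite comp_preimage; apply: measurable_finType_preimage.
apply: measurable_ffun_fiber => -[s' n] b.
have := measurable_cell_dist_slice n (shuffle_aut s').
move=> /(_ measurableT `]-oo, (n.+1%:R^-1)%:E[%classic (emeasurable_itv _)).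
rewrite setTI; set A := _ @^-1` _ => mA.
rewrite (_ : [set y | _] = if b then A else ~` A); last first.
  rewrite /A; apply/seteqP.
  case: b; split=> y /=; rewrite in_itv/= ffunE /fits/=.
  - by [].
  - by [].
  - by move=> ->.
  - by move/negP/negbTE.
by case: b => //; exact: measurableC.
Qed.

Lemma fits_mono M (s : 'S_(2 ^ M)) n K y :
  (n <= K)%N -> fits s K y -> fits s n y.
Proof.
move=> nK; rewrite /fits => h.
apply: le_lt_trans (cell_dist_mono nK _ _) _.
- exact: measurable_shuffle.
- exact: measurable_aut.
by apply: (lt_le_trans h); rewrite lee_fin lef_pV2 ?posrE// ler_nat.
Qed.

(** By monotonicity in the level the requirements that are met form an initial
segment, so the number of them that are met tells which ones. *)
Lemma best_shuffle_fits M (s : 'S_(2 ^ M)) K y :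
  (K < M)%N -> fits s K y -> fits (best_shuffle M y) K y.
Proof.
move=> KM sK; apply: contraT => bK; rewrite /best_shuffle in bK *.
move: bK; case: arg_maxnP => // b _ /(_ s isT) /= bs bK.
have : (K < \sum_(n < M) fits s n y)%N.
  rewrite -(big_mkord predT (fun n => fits s n y : nat)).
  rewrite (@big_cat_nat _ _ _ K.+1)//=.
  apply: leq_trans (leq_addr _ _).
  rewrite (eq_big_nat _ _ (F2 := fun=> 1%N)) ?sum_nat_const_nat ?subn0 ?muln1//.
  by move=> n /andP[_ nK]; rewrite (fits_mono (K := K)).
move=> /leq_trans /(_ bs); rewrite ltnNge.
rewrite -(big_mkord predT (fun n => fits b n y : nat)).
rewrite (@big_cat_nat _ _ _ K)//=; last exact: ltnW.
have -> : (\sum_(K <= n < M) fits b n y)%N = 0%N.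
  rewrite big_nat_cond big1// => n /andP[/andP[Kn _] _].
  apply/eqP; rewrite eqb0.
  by apply: contra bK; exact: fits_mono.
rewrite addn0.
suff -> : (\sum_(0 <= n < K) fits b n y <= K)%N by [].
rewrite -[leqRHS]subn0 -[leqRHS]muln1 -sum_nat_const_nat.
by apply: leq_sum => n _; exact: leq_b1.
Qed.

Lemma best_shuffle_cvg y n :
  cell_dist n (shuffle (best_shuffle M y)) (a y) @[M --> \oo] --> 0.
Proof.
have fin M : cell_dist n (shuffle (best_shuffle M y)) (a y) \is a fin_num.
  apply: fin_num_measure; apply: measurable_cell_neq.
    exact: measurable_shuffle.
  exact: measurable_aut.
apply/fine_cvgP; split; first exact: nearW.
apply/cvgr0Pnorm_lt => e e0; pose K := maxn n (Num.truncn e^-1).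
have K0 : (0 < K.+1%:R^-1 :> R)%R by rewrite invr_gt0.
have [M0 _ hM0] := shuffle_approx (a y) K K0.
exists (maxn K.+1 M0) => // M /=; rewrite geq_max => /andP[KM /hM0[s sK]].
rewrite ger0_norm ?fine_ge0 ?measure_ge0// -lte_fin fineK//.
have hK := best_shuffle_fits KM sK.
apply: le_lt_trans (cell_dist_mono (leq_maxl _ _ : n <= K)%N _ _) _.
- exact: measurable_shuffle.
- exact: measurable_aut.
apply: (lt_le_trans hK); rewrite lee_fin.
rewrite invf_ple ?posrE// (le_trans (ltW (truncnS_gt _)))//.
by rewrite ler_nat ltnS leq_maxr.
Qed.

End selection.

(** * Density of the rigid cocycles *)

Section density.
Context d (Y : measurableType d) (R : realType).
Notation m := (mI R).
Variables (nu : probability Y R) (S : mpaut nu).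

(** The symmetric difference of the preimages of E has as fiber at y the
symmetric difference of the preimages of the fiber of E at S y, so pointwise
weak convergence gives convergence by integration over y. *)
Lemma skew_product_cvg (beta : nat -> Co S) (alpha : Co S) :
  {ae nu, forall y, beta M y @[M --> \oo] --> alpha y} ->
  skew_product S (beta M) @[M --> \oo] --> skew_product S alpha.
Proof.
move=> ba; apply/weak_cvgP => E mE.
pose T M := repr (skew_product S (beta M)).
pose T0 := repr (skew_product S alpha).
have mD M : measurable (T M @^-1` E `+` T0 @^-1` E).
  by apply: measurable_setY; exact: measurable_mpaut_preimage.
pose u M y := m (xsection (T M @^-1` E `+` T0 @^-1` E) y).
suff : \int[nu]_y u M y @[M --> \oo] --> 0 by [].
apply: bounded_integral_cvg0.
- by move=> M; exact: (measurable_fun_xsection m (mD M)).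
- move=> M y; rewrite measure_ge0/= probability_le1//.
  exact: measurable_xsection.
have lifts : {ae nu, forall y, forall M, {ae m, forall t,
    T M (y, t) = (S y, repr (beta M y) t)}}.
  by apply: ae_foralln => M; exact: skew_productP.
apply: filterS3 ba lifts (skew_productP alpha) => y cvgy hM h0.
have mEy := measurable_xsection (S y) mE.
move/weak_cvgP : cvgy => /(_ _ mEy); rewrite (_ : (fun M => u M y) =
    (fun M => mAut_dist (xsection E (S y)) (beta M y) (alpha y)))//.
apply/funext => M; apply: ae_eq_measure; first exact: measurable_xsection.
  by apply: measurable_setY; exact: measurable_mpaut_preimage.
apply: filterS2 (hM M) h0 => t ht h0t.
by rewrite !xsectionE /setY/= ht /T0 h0t.
Qed.

Lemma rigid_dense : dense [set alpha : Co S | rigid alpha].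
Proof.
move=> O [alpha Oalpha] [U oU UO].
have sa := cocycle_slice_measurable alpha.
pose sigma M y := best_shuffle (fun y => repr ((alpha : Co S) y)) M y.
have /choice[beta hbeta] M : exists beta : Co S,
    {ae nu, forall y, beta y = shuffle_class (sigma M y)} /\ rigid beta.
  by apply: shuffle_cocycle; exact: measurable_best_shuffle.
have : skew_product S (beta M) @[M --> \oo] --> skew_product S alpha.
  apply: skew_product_cvg.
  have : {ae nu, forall y, forall M, beta M y = shuffle_class (sigma M y)}.
    by apply: ae_foralln => M; exact: (hbeta M).1.
  apply: filterS => y hy.
  rewrite (_ : (fun M => _) = fun M => shuffle_class (sigma M y)).
    apply: weak_cvg_cell_dist => n.
    have := best_shuffle_cvg (fun y => repr ((alpha : Co S) y)) y n.
    rewrite (_ : (fun M => _) = (fun M => cell_dist n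
      (repr (shuffle_class (sigma M y))) (repr ((alpha : Co S) y))))//.
    by apply/funext => M; rewrite cell_dist_class.
  by apply/funext => M; exact: hy.
have Ualpha : U (skew_product S alpha) by rewrite -UO in Oalpha.
move=> /(_ U (open_nbhs_nbhs (conj oU Ualpha)))[M0 _ hM].
exists (beta M0); split; last exact: (hbeta M0).2.
by rewrite -UO; exact: hM (leqnn _).
Qed.

End density.

Theorem theorem4p5 (R : realType) (d : measure_display) (Y : measurableType d)
    (nu : probability Y R) (S : mpaut nu)
    (hY : standard_borel R Y) (hS : ergodic S) :
  dense [set alpha : Co S | rigid alpha] /\
  Gdelta [set alpha : Co S | rigid alpha].
Proof. by split; [exact: rigid_dense|exact: rigid_Gdelta]. Qed.
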